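(* Assume $\varepsilon>0$, $\varepsilon\le\frac R8$, and that $\mathcal{X}_\varepsilon\subset\Omega_\varepsilon$ and $\partial_\varepsilon\mathcal{X}\subset\partial_{2\varepsilon}\Omega$. Let $u_\varepsilon:\mathcal{X}\to\mathbb{R}$ solve the graph eikonal equation $$\min_{y\in B_0(x^i,\varepsilon)\cap\mathcal{X}}\left\{u_\varepsilon(y)-u_\varepsilon(x^i)+|y-x^i|\right\}=0\ \text{ if }x^i\in\mathcal{X}_\varepsilon,\qquad u_\varepsilon(x^i)=0\ \text{ if }x^i\in\partial_\varepsilon\mathcal{X},$$ and let $0<t\le\min\left\{\frac1d,\frac12-\frac{4\varepsilon}{R}\right\}$. Then $$-2\varepsilon\le u_\varepsilon-d_\Omega\le 2d_\Omega\left(t+\frac{4\varepsilon}{R}\right)\quad\text{on }\mathcal{X}$$ holds with probability at least $$1-2n\exp\left(-\frac{\omega_{d-1}}{4(d+1)}\rho_{\min}\,n\,\varepsilon^d(2t)^{\frac{d+1}{2}}\right).$$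
   Context: Setting: $\Omega\subset\mathbb{R}^d$ is a bounded domain such that both $\Omega$ and $\mathbb{R}^d\setminus\Omega$ have reach at least $R>0$ (the reach of a set $A$ is the maximal distance such that every point $x$ whose distance to $A$ is at most this value has a unique nearest point in $\overline A$). $\rho:\mathbb{R}^d\to[0,\infty)$ is a probability density with $0<\rho_{\min}\le\rho\le\rho_{\max}<\infty$ on $\Omega$, $\rho=0$ outside $\Omega$, Lipschitz on $\Omega$. $\mathcal{X}=\{x^1,\dots,x^n\}$ is an i.i.d. sample with density $\rho$. $\omega_d$ is the volume of the unit ball in $\mathbb{R}^d$; $d_\Omega(x)=\mathrm{dist}(x,\partial\Omega)$; $B(x,\varepsilon)$ is the ball of radius $\varepsilon$ centered at $x$ and $B_0(x,\varepsilon)=B(x,\varepsilon)\setminus\{x\}$. For $a>0$, $\partial_a\Omega=\{x\in\Omega:\mathrm{dist}(x,\partial\Omega)\le a\}$ and $\Omega_a=\Omega\setminus\partial_a\Omega$. $\partial_\varepsilon\mathcal{X}\subset\mathcal{X}$ is a given subset of the point cloud (the set of points declared to be boundary points) and $\mathcal{X}_\varepsilon=\mathcal{X}\setminus\partial_\varepsilon\mathcal{X}$. The minimum over an empty set is $+\infty$. *)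

(* Defs.v *)
From HB Require Import structures.
From mathcomp Require Import all_boot all_order all_algebra.
From mathcomp Require Import all_classical all_reals all_analysis.

Set Implicit Arguments.
Unset Strict Implicit.
Unset Printing Implicit Defensive.

Import Order.TTheory GRing.Theory Num.Theory.
Import numFieldNormedType.Exports.

Local Open Scope classical_set_scope.
Local Open Scope ring_scope.

(* 'rV[T]_n carries the product sigma-algebra, generated by the coordinate maps;
   for T = R it is the Borel sigma-algebra of R^n. *)
Definition rV_display : measure_display -> measure_display.
Proof. exact. Qed.

Section measurable_rV.
Context {d} {T : sigmaRingType d}.
Variable n : nat.

Let coors : 'I_n -> 'rV[T]_n -> T := fun i x => x ord0 i.

Let rV_set0 : g_sigma_preimage coors set0.
Proof. exact: sigma_algebra0. Qed.

Let rV_setC A : g_sigma_preimage coors A -> g_sigma_preimage coors (~` A).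
Proof. exact: sigma_algebraC. Qed.

Let rV_bigcup (F : _^nat) : (forall i, g_sigma_preimage coors (F i)) ->
  g_sigma_preimage coors (\bigcup_i (F i)).
Proof. exact: sigma_algebra_bigcup. Qed.

HB.instance Definition _ := @isMeasurable.Build (rV_display d)
  'rV[T]_n (g_sigma_preimage coors) rV_set0 rV_setC rV_bigcup.

End measurable_rV.


Lemma measurable_rV_coord d (T : sigmaRingType d) n (i : 'I_n) :
  measurable_fun [set: 'rV[T]_n] (fun x => x ord0 i).
Proof.
move=> _ Y mY; rewrite setTI; apply: sub_sigma_algebra => /=.
rewrite -bigcup_seq/=; exists i => /=; first by rewrite mem_index_enum.
by exists Y => //; rewrite setTI.
Qed.

Lemma measurable_fun_rVP d1 d2 (T1 : measurableType d1) (T2 : measurableType d2)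
    n (f : T1 -> 'rV[T2]_n) :
  (forall i, measurable_fun [set: T1] (fun x => f x ord0 i)) ->
  measurable_fun [set: T1] f.
Proof.
move=> mf _ A; rewrite setTI => mA.
pose F := [set B : set 'rV[T2]_n | measurable (f @^-1` B)].
suff : F A by [].
apply: mA => /=; split.
  split=> [|B FB|B FB]; rewrite /F/=.
  - by rewrite preimage_set0.
  - by rewrite setTD preimage_setC; exact: measurableC.
  - by rewrite preimage_bigcup; apply: bigcup_measurable => k _; exact: FB.
move=> B; rewrite -bigcup_seq => -[i _] [C mC <-].
by rewrite /F/= setTI -[X in measurable X]setTI; exact: (mf i).
Qed.

Section lebesgue_rV.
Context {R : realType}.
Local Open Scope ereal_scope.

Definition consrV n (p : 'rV[R]_n * R) : 'rV[R]_n.+1 :=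
  \row_i oapp (fun j => p.1 ord0 j) p.2 (unlift ord0 i).

Lemma consrV0 n p : @consrV n p ord0 ord0 = p.2.
Proof. by rewrite mxE unlift_none. Qed.

Lemma consrV_lift n p j : @consrV n p ord0 (lift ord0 j) = p.1 ord0 j.
Proof. by rewrite mxE liftK. Qed.

Lemma measurable_consrV n : measurable_fun setT (@consrV n).
Proof.
apply: measurable_fun_rVP => i; case: (unliftP ord0 i) => [j ->|->].
  under eq_fun do rewrite consrV_lift.
  by apply: (measurableT_comp (measurable_rV_coord j)); exact: measurable_fst.
by under eq_fun do rewrite consrV0; exact: measurable_snd.
Qed.

Section step.
Variables (n : nat) (m : {measure set 'rV[R]_n -> \bar R}).

Definition prod_lebesgue : set 'rV[R]_n.+1 -> \bar R :=
  pushforward (m \x @lebesgue_measure R) (@consrV n).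

Let mE A : measurable A -> measurable (@consrV n @^-1` A).
Proof. by move=> mA; rewrite -[X in measurable X]setTI; exact: measurable_consrV. Qed.

Let m0 : prod_lebesgue set0 = 0.
Proof. by rewrite /prod_lebesgue /pushforward preimage_set0 measure0. Qed.

Let m_ge0 A : 0 <= prod_lebesgue A.
Proof. by rewrite /prod_lebesgue /pushforward measure_ge0. Qed.

Let m_sigma_additive : semi_sigma_additive prod_lebesgue.
Proof.
move=> F mF tF mUF; rewrite /prod_lebesgue /pushforward preimage_bigcup.
apply: measure_semi_sigma_additive.
- by move=> k; exact: mE.
- apply/trivIsetP => /= i j _ _ ij; rewrite -preimage_setI.
  by move/trivIsetP : tF => /(_ _ _ _ _ ij) ->//; rewrite preimage_set0.
- by rewrite -preimage_bigcup; exact: mE.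
Qed.

HB.instance Definition _ := isMeasure.Build _ _ _ prod_lebesgue
  m0 m_ge0 m_sigma_additive.

End step.

(* Lebesgue measure on R^n, as an iterated product; see lebesgue_rV_box. *)
Fixpoint lebesgue_rV (n : nat) : {measure set 'rV[R]_n -> \bar R} :=
  match n with
  | 0%N => \d_(0%R : 'rV[R]_0)
  | k.+1 => prod_lebesgue (lebesgue_rV k)
  end.

Lemma lebesgue_rV_box n (a b : 'rV[R]_n) : (forall i, a ord0 i <= b ord0 i)%R ->
  lebesgue_rV n [set x | forall i, (a ord0 i <= x ord0 i <= b ord0 i)%R] =
  (\prod_(i < n) (b ord0 i - a ord0 i))%:E.
Proof.
elim: n => [|n IHn] in a b *; move=> ab /=.
  by rewrite big_ord0 diracE mem_set// => -[].
rewrite /prod_lebesgue /pushforward big_ord_recl.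
pose a' := (\row_(j < n) a ord0 (lift ord0 j))%R.
pose b' := (\row_(j < n) b ord0 (lift ord0 j))%R.
have -> : @consrV n @^-1` [set x | forall i, (a ord0 i <= x ord0 i <= b ord0 i)%R] =
    [set x : 'rV[R]_n | forall i, (a' ord0 i <= x ord0 i <= b' ord0 i)%R] `*`
    `[a ord0 ord0, b ord0 ord0].
  apply/seteqP; split => [p /= h|p /= [h1 h2] i].
    split=> [i|]; first by rewrite !mxE -consrV_lift.
    by rewrite in_itv/= -consrV0.
  case: (unliftP ord0 i) => [j ->|->].
    by have := h1 j; rewrite !mxE liftK.
  by rewrite consrV0; move: h2; rewrite in_itv.
rewrite product_measure1E//; last first.
  rewrite [X in measurable X](_ : _ = \big[setI/setT]_(i < n)
    ((fun x : 'rV[R]_n => x ord0 i) @^-1` `[a' ord0 i, b' ord0 i])).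
    apply: bigsetI_measurable => i _; rewrite -[X in measurable X]setTI.
    exact: measurable_rV_coord.
  rewrite -bigcap_seq; apply/seteqP; split=> x /= h i.
    by move=> _; rewrite /= in_itv; exact: h.
  by have := h i (mem_index_enum i); rewrite /= in_itv.
rewrite IHn => [|i]; last by rewrite !mxE; exact: ab.
rewrite [X in _ * X = _](_ : _ = (b ord0 ord0 - a ord0 ord0)%:E); last first.
  apply: (eq_trans (lebesgue_measure_itv `[a ord0 ord0, b ord0 ord0])).
  rewrite /= lte_fin.
  case: ltP => [_|ba]; first by rewrite EFinB.
  by congr EFin; apply/esym/eqP; rewrite subr_eq0 eq_le ba ab.
rewrite -EFinM mulrC; congr (_ * _)%:E.
by apply: eq_bigr => i _; rewrite !mxE.
Qed.

End lebesgue_rV.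

Section euclidean_geometry.
Context {R : realType} {d : nat}.
Implicit Types (x y : 'rV[R]_d) (A Omega : set 'rV[R]_d).

(* The library norm of 'rV[R]_d is the sup norm. It induces the same open,
   closed, bounded and connected sets and the same Lipschitz functions as the
   Euclidean norm, but not the same distances. *)
Definition enorm x : R := Num.sqrt (\sum_(i < d) x ord0 i ^+ 2).

Definition eball x (r : R) : set 'rV[R]_d := [set y | enorm (y - x) < r].

Definition punctured_ball x (r : R) : set 'rV[R]_d := eball x r `\ x.

(* Meaningful for A nonempty only, since inf set0 = 0. *)
Definition edist x A : R := inf [set enorm (x - y) | y in A].

Definition nearest_point x A y := closure A y /\ enorm (x - y) = edist x A.

(* A supremum, because the maximum need not be attained: the complement of a
   ball of radius r has reach r, but the center has no unique nearest point. *)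
Definition reach A : \bar R :=
  ereal_sup [set r%:E | r in [set r : R | 0 <= r /\
    forall x, edist x A <= r -> exists! y, nearest_point x A y]].

Definition frontier A : set 'rV[R]_d := closure A `\` interior A.

Definition bdist Omega x : R := edist x (frontier Omega).

Definition boundary_layer Omega (a : R) : set 'rV[R]_d :=
  [set x | Omega x /\ bdist Omega x <= a].

Definition inner_part Omega (a : R) : set 'rV[R]_d :=
  Omega `\` boundary_layer Omega a.

Definition bounded_domain Omega :=
  [/\ Omega !=set0, open Omega, connected Omega & bounded_set Omega].

(* Only the values of u on Xs are constrained. The infimum ranges over a finite
   set when Xs is finite, hence is a minimum, with value +oo on the empty set. *)
Definition graph_eikonal (Xs dXs : set 'rV[R]_d) (eps : R)
    (u : 'rV[R]_d -> R) :=
  (forall x, (Xs `\` dXs) x ->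
    ereal_inf [set (u y - u x + enorm (y - x))%:E
              | y in punctured_ball x eps `&` Xs] = 0%E) /\
  (forall x, dXs x -> u x = 0).

Definition is_density (rho : 'rV[R]_d -> R) :=
  [/\ measurable_fun setT rho, forall x, 0 <= rho x &
      (\int[lebesgue_rV d]_x (rho x)%:E = 1)%E].

End euclidean_geometry.

Definition unit_ball_volume (R : realType) (k : nat) : R :=
  fine (lebesgue_rV k (@eball R k 0 1)).

Section iid_sample.
Context {dT} {T : measurableType dT} {R : realType} (P : probability T R).
Local Open Scope ereal_scope.

Definition mutually_independent {d'} {T' : measurableType d'} {n : nat}
    (X : 'I_n -> {RV P >-> T'}) :=
  forall (J : {set 'I_n}) (A : 'I_n -> set T'), (forall i, measurable (A i)) ->
    P (\bigcap_(i in [set` J]) (X i @^-1` A i)) =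
    \prod_(i in J) P (X i @^-1` A i).

Definition has_density {d : nat} (X : {RV P >-> 'rV[R]_d}) (rho : 'rV[R]_d -> R) :=
  forall A, measurable A ->
    distribution P X A = \int[lebesgue_rV d]_(x in A) (rho x)%:E.

Definition iid_sample {d n : nat} (X : 'I_n -> {RV P >-> 'rV[R]_d})
    (rho : 'rV[R]_d -> R) :=
  mutually_independent X /\ forall i, has_density (X i) rho.

(* F itself need not be measurable. *)
Definition holds_with_probability_at_least (p : R) (F : set T) :=
  exists E, [/\ measurable E, E `<=` F & p%:E <= P E].

End iid_sample.

Definition point_cloud {T : Type} {V : Type} {n : nat} (X : 'I_n -> T -> V)
    (w : T) : set V := [set X i w | i in [set: 'I_n]].

(* Main.v *)
From HB Require Import structures.
Require Import Defs.
From mathcomp Require Import all_boot all_order all_algebra.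
From mathcomp Require Import all_classical all_reals all_analysis.
From mathcomp Require Import measurable_realfun ring lra.

(** Write [D] for the distance to the boundary.

    The lower bound is deterministic.  At a point where the equation holds the
    minimum is attained by a neighbour whose value of [u] is smaller by exactly
    the length of the step, while [D] changes by at most that length; so a point
    violating [D - 2 eps <= u] would have a neighbour violating it with a smaller
    value of [u], and descent ends in the declared boundary points, where
    [u = 0] and [D <= 2 eps] ([eikonal_ge]).

    For the upper bound, the equation gives [u x <= u y + |y - x|] for every
    neighbour [y] of [x], so it suffices that each sample point [x] with
    [D x > eps] sees another sample point [y] such that the step from [x] to [y]
    is efficient.  Let [z] be close to [x], let [p] be a boundary point almost
    nearest to [z], and use no more about [D] than [D y <= |y - p|].  The point
    [y] is looked for in a cylinder around the segment from [z] to [p], at height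
    somewhat below [eps] and of radius [eps sqrt (2 t) (1 - t)]
    ([step_cylinder]).  There is a threshold of nearly [2 eps] for small [t]
    ([one_step_range]), and there are three cases ([good_step]).  If [D x] is at
    most the threshold, then [D y <= eps], so [y] is a declared boundary point and
    [u x <= eps].  If [D x] is larger but [D y] is not, then [u x <= 2 eps], which
    is at most [1 + 2 t] times the threshold.  Otherwise the segment is long, the
    transverse displacement costs little, and
    [|y - x| <= (1 + 2 t) (D x - D y)].  Summing along the
    path, [u <= (1 + 2 t) D] ([eikonal_upper]).

    The volume of the cylinder is its height times the volume of its base
    ([lebesgue_rV_cylinder]); for a cylinder that is not parallel to an axis this
    rests on the invariance of Lebesgue measure under reflections.  With
    Bernoulli's inequality, a given sample point lies in a given cylinder with
    probability at least [q], where [- n q] is the exponent in the theorem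
    ([step_prob_ge]).  The cylinder depends on [x] through the choice of [p],
    which need not be measurable; hence one cylinder is fixed for each cell of a
    fine grid, the margin [slack] absorbing the displacement from [x] to the
    representative [z] of its cell.  Independence then bounds the probability
    that sample point [i] lies in some cell and all others miss the cylinder of
    that cell by [(1 - q) ^ (n - 1)], and there are [n] choices of [i]
    ([hitting_event]).  The factor [2] of the theorem pays for the exponent
    [n - 1] in place of [n], as [exp q <= 2]: twice the cylinder still fits in
    the domain, so [q <= 1 / 2]. *)

Set Implicit Arguments.
Unset Strict Implicit.
Unset Printing Implicit Defensive.

Import Order.TTheory GRing.Theory Num.Theory.
Import numFieldNormedType.Exports.

Local Open Scope classical_set_scope.
Local Open Scope ring_scope.

(** * The shape of a step *)

Section shape.
Variable R : realType.
Implicit Types t a w D r M : R.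

(** In units of the step radius: a step starts at the origin of an axis pointing
    to a boundary point at distance [D], and ends at height [a] between
    [near_end t] and [far_end t] with squared transverse displacement [w] at most
    [sqradius t].  The constants are a compromise between five requirements: the
    step is shorter than [1]; from [D <= 2 near_end] it ends within distance [1]
    of the boundary point; two steps are worth it from [2 near_end] on, that is,
    [(1 + 2 t) (2 near_end) >= 2]; longer paths consist of efficient steps
    ([step_efficient]); and the volume is large enough, which comes down to
    [(1 - t) ^ (d - 1) (far_end - near_end) >= t / (2 (d + 1))] for [t <= 1 / d].
    The margin [slack t] is of order [t ^ 2] because the first requirement leaves
    no more. *)
Definition near_end t : R := 1 - 3/2 * t + 5/3 * t ^+ 2.
Definition far_end t : R := 1 - t + 4/3 * t ^+ 2.
Definition sqradius t : R := 2 * t * (1 - t) ^+ 2.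
Definition slack t : R := t ^+ 2 / 100.

(** Points of the domain closer than this to the boundary reach the boundary
    layer in one step. *)
Definition one_step_range t : R := 2 * near_end t - slack t.

Lemma near_end_bounds t : 0 < t <= 1/2 -> 1/2 <= near_end t <= far_end t /\ far_end t <= 1.
Proof. rewrite /near_end /far_end => /andP[t0 t1]; split; nra. Qed.

Lemma slack_bounds t : 0 < t <= 1/2 -> 0 < slack t <= 1/100.
Proof. rewrite /slack => /andP[t0 t1]; nra. Qed.

Lemma step_length_lt1 t a w r : 0 < t <= 1/2 -> 0 <= a <= far_end t -> 0 <= w <= sqradius t ->
  0 <= r -> r ^+ 2 = a ^+ 2 + w -> r + slack t < 1.
Proof.
move=> tb /andP[a0 a1] /andP[w0 w1] r0 rE.
have /andP[s0 s1] := slack_bounds tb.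
case/andP: tb => t0 t1.
have r2 : r ^+ 2 < (1 - slack t) ^+ 2.
  rewrite rE; have : a ^+ 2 <= far_end t ^+ 2 by nra.
  move: w1; rewrite /sqradius /far_end /slack => w1 a2.
  have : 0 < t ^+ 2 * (1/2 - t + 1/ 100).
    by apply: mulr_gt0; [exact: exprn_gt0|lra].
  have : 0 < t ^+ 2 by exact: exprn_gt0.
  have : 0 <= t ^+ 2 * (t * (1/2 - t)).
    by rewrite mulr_ge0 ?sqr_ge0//; nra.
  nra.
have : r < 1 - slack t by rewrite -(@ltr_pXn2r _ 2)// nnegrE; lra.
lra.
Qed.

(** With [r] the length of the step, [M ^ 2 = D (D - 2 a) + r ^ 2], where the
    first term is nonpositive and [r < 1]. *)
Lemma cylinder_point_in_layer t a D w M : 0 < t <= 1/2 ->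
  near_end t <= a <= far_end t -> 0 <= w <= sqradius t ->
  0 <= M -> M ^+ 2 = (D - a) ^+ 2 + w -> 0 <= D <= 2 * near_end t -> M <= 1.
Proof.
move=> tb ab wb M0 ME /andP[D0 D1].
have [/andP[n0 n1] f1] := near_end_bounds tb.
case/andP: ab => a0 a1.
have r2 : (Num.sqrt (a ^+ 2 + w)) ^+ 2 = a ^+ 2 + w by rewrite sqr_sqrtr//; nra.
have := @step_length_lt1 t a w _ tb _ wb (sqrtr_ge0 _) r2.
have /andP[s0 s1] := slack_bounds tb.
have q0 := sqrtr_ge0 (a ^+ 2 + w).
move=> /(_ _); have -> : 0 <= a <= far_end t by lra.
move=> /(_ isT) q1.
rewrite -(@ler_pXn2r _ 2)// ?nnegrE// ME expr1n; nra.
Qed.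

Lemma one_step_range_ge t : 0 < t <= 1/2 -> 2 <= (1 + 2 * t) * one_step_range t.
Proof.
move=> /andP[t0 t1]; rewrite /one_step_range /near_end /slack.
have : 0 <= t * (t - 1/5) ^+ 2 by rewrite mulr_ge0 ?sqr_ge0 ?ltW.
nra.
Qed.

(** What is left of [step_efficient] after clearing denominators.  The polynomial
    has degree six, and its Bernstein coefficients in degree eight on [0, 1/2] are
    nonnegative. *)
Lemma step_efficient_poly t : 0 < t <= 1/2 ->
  0 <= 2 * near_end t ^+ 2 * (one_step_range t + (2 - 7/2 * t + 3 * t ^+ 2))
     - 2 * (1 + 2 * t) * (1 - t) ^+ 2 * near_end t
     - (1 - t) ^+ 2 * (one_step_range t + (2 - 7/2 * t + 3 * t ^+ 2))
     - (2 + 2 * t) * t / 100 * near_end t * (one_step_range t + (2 - 7/2 * t + 3 * t ^+ 2)).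
Proof.
move=> /andP[t0 t1]; rewrite /one_step_range /near_end /slack.
have B k : 0 <= t ^+ k * (1 - 2 * t) ^+ (8 - k) by rewrite mulr_ge0// exprn_ge0//; lra.
have := (B 0%N, B 1%N, B 2%N, B 3%N, B 4%N, B 5%N, B 6%N, B 7%N, B 8%N).
rewrite /= !subSS !subn0; case=> [[[[[[[[b0 b1] b2] b3] b4] b5] b6] b7] b8].
lra.
Qed.

(** The two square roots are linearised: [r <= a + w / (2 a)] and
    [M <= (D - a) + w / (M + (D - a))].  Both corrections are of order [t], and
    the second is small enough because [M] is at least about [2]. *)
Lemma step_efficient t a D w r M : 0 < t <= 1/2 ->
  near_end t <= a <= far_end t -> 0 <= w <= sqradius t ->
  0 <= r -> r ^+ 2 = a ^+ 2 + w -> 0 <= M -> M ^+ 2 = (D - a) ^+ 2 + w -> 1 <= D ->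
  one_step_range t <= M -> r + slack t <= (1 + 2 * t) * (D - M - slack t).
Proof.
move=> tb ab /andP[w0 w1] r0 rE M0 ME D1 M2.
have [/andP[n0 n1] f1] := near_end_bounds tb.
have /andP[s0 s1] := slack_bounds tb.
have key := step_efficient_poly tb.
case/andP: ab => a0 a1; case/andP: (tb) => t0 t1.
have T0 : 0 < one_step_range t by rewrite /one_step_range; lra.
set F := D - a in ME; have F0 : 0 <= F by rewrite /F; lra.
have /eqP DE : D == F + a by rewrite /F; lra.
(* A polynomial lower bound for the height [F] left to the boundary point, with
   the right expansion at [t = 0] up to first order. *)
set f := 2 - 7/2 * t + 3 * t ^+ 2 in key.
have f0 : 0 < f by rewrite /f; nra.
have Ff : f <= F.
  rewrite -(@ler_pXn2r _ 2)// ?nnegrE//; last exact: ltW.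
  have -> : F ^+ 2 = M ^+ 2 - w by rewrite ME; ring.
  have : one_step_range t ^+ 2 <= M ^+ 2.
    by rewrite ler_pXn2r// nnegrE ltW.
  move=> M3; suff f3 : f ^+ 2 <= one_step_range t ^+ 2 - sqradius t.
    by apply: (le_trans f3); apply: lerB.
  have : 0 <= t ^+ 2 * (1 / 2 - t) by rewrite mulr_ge0 ?sqr_ge0//; lra.
  have : 0 <= t ^+ 2 by exact: sqr_ge0.
  have : 0 <= t ^+ 4 by rewrite exprn_ge0// ltW.
  rewrite /f /one_step_range /near_end /slack /sqradius; lra.
set S := one_step_range t + f in key.
have S0 : 0 < S by rewrite /S /one_step_range; lra.
have SM : S <= M + F by rewrite /S; lra.
have FM : F <= M by rewrite -(@ler_pXn2r _ 2)// ?nnegrE// ME; lra.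
have MF : (M - F) * S <= w.
  have -> : w = (M - F) * (M + F) by rewrite -subr_sqr ME; ring.
  by apply: ler_wpM2l => //; lra.
have ra : (r - a) * (2 * near_end t) <= w.
  have ar : a <= r by rewrite -(@ler_pXn2r _ 2)// ?nnegrE// ?rE; lra.
  have -> : w = (r - a) * (r + a) by rewrite -subr_sqr rE; ring.
  by apply: ler_wpM2l; lra.
have M'F : M - F <= sqradius t / S by rewrite ler_pdivlMr//; lra.
have r'a : r - a <= sqradius t / (2 * near_end t).
  by rewrite ler_pdivlMr; lra.
suff : 0 <= 2 * t * near_end t - (1 + 2 * t) * (sqradius t / S)
   - sqradius t / (2 * near_end t) - (2 + 2 * t) * slack t.
  have : 2 * t * near_end t <= 2 * t * a by nra.
  have : (1 + 2 * t) * (M - F) <= (1 + 2 * t) * (sqradius t / S) by nra.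
  rewrite DE; lra.
have -> : 2 * t * near_end t - (1 + 2 * t) * (sqradius t / S)
   - sqradius t / (2 * near_end t) - (2 + 2 * t) * slack t =
   t * (2 * near_end t ^+ 2 * S - 2 * (1 + 2 * t) * (1 - t) ^+ 2 * near_end t
     - (1 - t) ^+ 2 * S - (2 + 2 * t) * t / 100 * near_end t * S) / (S * near_end t).
  rewrite /sqradius /slack; field; lra.
apply: divr_ge0; first by apply: mulr_ge0; [exact: ltW|exact: key].
by apply: mulr_ge0; lra.
Qed.

End shape.

(** * Euclidean geometry of row vectors *)

Section euclidean.
Context {R : realType} {d : nat}.
Implicit Types x y z v : 'rV[R]_d.

Definition dot x y : R := \sum_i x ord0 i * y ord0 i.

Lemma dotC x y : dot x y = dot y x.
Proof. by apply: eq_bigr => i _; rewrite mulrC. Qed.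

Lemma dotDl x y z : dot (x + y) z = dot x z + dot y z.
Proof. by rewrite -big_split; apply: eq_bigr => i _; rewrite mxE mulrDl. Qed.

Lemma dotZl k x y : dot (k *: x) y = k * dot x y.
Proof. by rewrite mulr_sumr; apply: eq_bigr => i _; rewrite mxE mulrA. Qed.

Lemma dotNl x y : dot (- x) y = - dot x y.
Proof. by rewrite -scaleN1r dotZl mulN1r. Qed.

Lemma dotBl x y z : dot (x - y) z = dot x z - dot y z.
Proof. by rewrite dotDl dotNl. Qed.

Lemma dotDr x y z : dot z (x + y) = dot z x + dot z y.
Proof. by rewrite dotC dotDl !(dotC _ z). Qed.

Lemma dotZr k x y : dot x (k *: y) = k * dot x y.
Proof. by rewrite dotC dotZl dotC. Qed.

Lemma dotBr x y z : dot z (x - y) = dot z x - dot z y.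
Proof. by rewrite dotC dotBl !(dotC _ z). Qed.

Lemma dot_ge0 x : 0 <= dot x x.
Proof. by apply: sumr_ge0 => i _; rewrite -expr2 sqr_ge0. Qed.

Lemma dot_eq0 x : (dot x x == 0) = (x == 0).
Proof.
rewrite psumr_eq0 => [|i _]; last by rewrite -expr2 sqr_ge0.
apply/allP/eqP => [h|-> i _]; last by rewrite !mxE mulr0 eqxx implybT.
apply/rowP => i; rewrite mxE; have := h i (mem_index_enum i).
by rewrite /= mulf_eq0 orbb => /eqP.
Qed.

Lemma enormE x : enorm x = Num.sqrt (dot x x).
Proof. by congr Num.sqrt; apply: eq_bigr => i _; rewrite expr2. Qed.

Lemma sqr_enorm x : enorm x ^+ 2 = dot x x.
Proof. by rewrite enormE sqr_sqrtr// dot_ge0. Qed.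

Lemma enorm_ge0 x : 0 <= enorm x. Proof. exact: sqrtr_ge0. Qed.

Lemma enorm0 : enorm (0 : 'rV[R]_d) = 0.
Proof. by apply/eqP; rewrite -sqrf_eq0 sqr_enorm dot_eq0. Qed.

Lemma enorm_eq0 x : (enorm x == 0) = (x == 0).
Proof. by rewrite -sqrf_eq0 sqr_enorm dot_eq0. Qed.

Lemma enormN x : enorm (- x) = enorm x.
Proof. by rewrite !enormE dotNl dotC dotNl opprK. Qed.

Lemma enormZ k x : 0 <= k -> enorm (k *: x) = k * enorm x.
Proof.
move=> k0; rewrite !enormE dotZl dotZr mulrA sqrtrM ?mulr_ge0// -expr2.
by rewrite sqrtr_sqr ger0_norm.
Qed.

Lemma enorm_distC x y : enorm (x - y) = enorm (y - x).
Proof. by rewrite -enormN opprB. Qed.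

(** Cauchy-Schwarz: the squared norm of [|y|^2 x - (x.y) y] is nonnegative. *)
Lemma dot_le x y : dot x y <= enorm x * enorm y.
Proof.
have [->|y0] := eqVneq y 0; first by rewrite -[X in dot _ X](scale0r 0) dotZr mul0r enorm0 mulr0.
have yy0 : 0 < dot y y by rewrite lt_def dot_eq0 y0 dot_ge0.
have := dot_ge0 (dot y y *: x - dot x y *: y).
rewrite !(dotBl, dotBr, dotZl, dotZr) (dotC y x) => h.
have le2 : dot x y ^+ 2 <= (enorm x * enorm y) ^+ 2.
  rewrite exprMn !sqr_enorm -(ler_pM2l yy0); nra.
have [xy|/ltW xy] := leP 0 (dot x y).
  by rewrite -(@ler_pXn2r _ 2)// nnegrE// mulr_ge0 ?enorm_ge0.
by apply: le_trans xy _; rewrite mulr_ge0 ?enorm_ge0.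
Qed.

Lemma ler_enormD x y : enorm (x + y) <= enorm x + enorm y.
Proof.
rewrite -(@ler_pXn2r _ 2)// ?nnegrE ?addr_ge0 ?enorm_ge0//.
rewrite sqr_enorm dotDl !dotDr sqrrD !sqr_enorm (dotC y x).
have := dot_le x y; lra.
Qed.

Lemma ler_dist_enorm x y z : enorm (x - z) <= enorm (x - y) + enorm (y - z).
Proof. by have := ler_enormD (x - y) (y - z); rewrite addrA subrK. Qed.

(** The orthogonal reflection along [v], which is the identity when [v = 0]. *)
Definition reflection v x := x - (2 * dot x v / dot v v) *: v.

Lemma reflectionD v : {morph reflection v : x y / x + y}.
Proof.
by move=> x y; rewrite /reflection dotDl mulrDr mulrDl scalerDl opprD addrACA.
Qed.

Lemma reflectionZ v k x : reflection v (k *: x) = k *: reflection v x.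
Proof.
by rewrite /reflection dotZl scalerBr scalerA; congr (_ - _ *: _); ring.
Qed.

Lemma reflectionB v x y : reflection v (x - y) = reflection v x - reflection v y.
Proof. by rewrite reflectionD -scaleN1r reflectionZ scaleN1r. Qed.

Lemma enorm_reflection v x : enorm (reflection v x) = enorm x.
Proof.
rewrite !enormE; congr Num.sqrt.
have [->|v0] := eqVneq v 0; first by rewrite /reflection scaler0 subr0.
have vv0 : dot v v != 0 by rewrite dot_eq0.
rewrite /reflection !(dotBl, dotBr, dotZl, dotZr) (dotC v x); field.
by [].
Qed.

Lemma reflectionK v : involutive (reflection v).
Proof.
move=> x; have [->|v0] := eqVneq v 0; first by rewrite /reflection !scaler0 !subr0.
have vv0 : dot v v != 0 by rewrite dot_eq0.
rewrite /reflection dotBl dotZl -addrA -opprD -scalerDl.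
rewrite -[RHS]subr0 -[X in _ = _ - X](scale0r v); congr (_ - _ *: _).
by field.
Qed.

(** This reflection turns any given direction into a coordinate direction. *)
Lemma reflection_swap x y : enorm x = enorm y -> reflection (x - y) x = y.
Proof.
move=> xy; have /(congr1 (fun r => r ^+ 2)) := xy; rewrite !sqr_enorm => xxyy.
have [/eqP|xy0] := eqVneq (x - y) 0.
  by rewrite subr_eq0 /reflection => /eqP ->; rewrite subrr scaler0 subr0.
have vv0 : dot (x - y) (x - y) != 0 by rewrite dot_eq0.
rewrite /reflection (_ : _ / _ = 1) ?scale1r ?subKr//.
have -> : 2 * dot x (x - y) = dot (x - y) (x - y).
  by rewrite !(dotBl, dotBr) (dotC y x) -xxyy; ring.
by rewrite divff.
Qed.

Lemma dot_reflection v x y : dot (reflection v x) (reflection v y) = dot x y.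
Proof.
have [->|v0] := eqVneq v 0; first by rewrite /reflection !scaler0 !subr0.
have vv0 : dot v v != 0 by rewrite dot_eq0.
rewrite /reflection !(dotBl, dotBr, dotZl, dotZr) (dotC v y); field.
by [].
Qed.

Definition cylinder z v (s1 s2 b : R) : set 'rV[R]_d :=
  [set y | s1 <= dot (y - z) v <= s2 /\
           enorm (y - z - dot (y - z) v *: v) < b].

Lemma edist_le x (A : set 'rV[R]_d) y : A y -> Defs.edist x A <= enorm (x - y).
Proof.
move=> Ay; apply: ge_inf; last by exists y.
by exists 0 => _ [z _ <-]; exact: enorm_ge0.
Qed.

Lemma edist_ge0 x (A : set 'rV[R]_d) : 0 <= Defs.edist x A.
Proof.
have [[y Ay]|/set0P/negP/negPn/eqP ->] := pselect (A !=set0); last first.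
  by rewrite /Defs.edist image_set0 inf0.
apply: lb_le_inf; first by exists (enorm (x - y)), y.
by move=> _ [z _ <-]; exact: enorm_ge0.
Qed.

Lemma edist_lipschitz x y (A : set 'rV[R]_d) : Defs.edist x A <= Defs.edist y A + enorm (x - y).
Proof.
have [[a Aa]|/set0P/negP/negPn/eqP ->] := pselect (A !=set0); last first.
  by rewrite /Defs.edist !image_set0 inf0 add0r enorm_ge0.
rewrite -lerBlDr; apply: lb_le_inf; first by exists (enorm (y - a)), a.
move=> _ [z Az <-]; rewrite lerBlDr.
by apply: le_trans (edist_le x Az) _; rewrite [leRHS]addrC; exact: ler_dist_enorm.
Qed.

Lemma edist_approx x (A : set 'rV[R]_d) e : 0 < e -> 0 < Defs.edist x A ->
  exists2 y, A y & enorm (x - y) < Defs.edist x A + e.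
Proof.
move=> e0 d0.
have [[a Aa]|/set0P/negP/negPn/eqP A0] := pselect (A !=set0); last first.
  by move: d0; rewrite A0 /Defs.edist image_set0 inf0 ltxx.
have hi : has_inf [set enorm (x - y) | y in A].
  split; first by exists (enorm (x - a)), a.
  by exists 0 => _ [z _ <-]; exact: enorm_ge0.
by have [_ [y Ay <-] h] := inf_adherent e0 hi; exists y.
Qed.

End euclidean.

(** * Invariance of Lebesgue measure and the volume of a cylinder *)

Section row_measurability.
Context {R : realType}.

Lemma measurable_preimage d1 d2 (T1 : measurableType d1) (T2 : measurableType d2)
    (f : T1 -> T2) A :
  measurable_fun setT f -> measurable A -> measurable (f @^-1` A).
Proof. by move=> mf mA; rewrite -[X in measurable X]setTI; exact: mf. Qed.

Lemma measurable_rVD d (T : measurableType d) n (f g : T -> 'rV[R]_n) :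
  measurable_fun setT f -> measurable_fun setT g ->
  measurable_fun setT (fun x => f x + g x).
Proof.
move=> mf mg; apply: measurable_fun_rVP => i.
rewrite (_ : (fun x => _) = (fun x => f x ord0 i) \+ (fun x => g x ord0 i)).
  by apply: measurable_funD; apply: (measurableT_comp (measurable_rV_coord i)).
by apply/funext => x; rewrite !mxE.
Qed.

Lemma measurable_rVZ d (T : measurableType d) n (k : T -> R) (f : T -> 'rV[R]_n) :
  measurable_fun setT k -> measurable_fun setT f ->
  measurable_fun setT (fun x => k x *: f x).
Proof.
move=> mk mf; apply: measurable_fun_rVP => i.
rewrite (_ : (fun x => _) = (k \* (fun x => f x ord0 i))).
  apply: measurable_funM => //.
  by apply: (measurableT_comp (measurable_rV_coord i)).
by apply/funext => x; rewrite !mxE.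
Qed.

Lemma measurable_rV_dot n (v : 'rV[R]_n) :
  measurable_fun setT (fun x : 'rV[R]_n => \sum_i x ord0 i * v ord0 i).
Proof.
apply: measurable_sum => i; apply: measurable_funM => //.
exact: measurable_rV_coord.
Qed.

Lemma measurable_enorm n : measurable_fun setT (@enorm R n).
Proof.
apply: (@measurableT_comp _ _ _ _ _ _ (@Num.sqrt R)).
  by apply: continuous_measurable_fun; exact: sqrt_continuous.
by apply: measurable_sum => i; apply: measurable_funX; exact: measurable_rV_coord.
Qed.

Lemma measurable_eball n (x : 'rV[R]_n) r : measurable (eball x r).
Proof.
rewrite /eball.
rewrite (_ : [set _ | _] = (fun y => enorm (y - x)) @^-1` `]-oo, r[).
  apply: measurable_preimage => //.
  apply: (measurableT_comp (@measurable_enorm n)).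
  exact: measurable_rVD.
by apply/seteqP; split => y; rewrite /= in_itv.
Qed.

End row_measurability.

Section lebesgue_rV_theory.
Context {R : realType}.
Local Open Scope ereal_scope.

Lemma lebesgue_measure_shift (c : R) (A : set R) : measurable A ->
  lebesgue_measure ((fun x : measurableTypeR R => (x + c)%R : measurableTypeR R) @^-1` A) =
  lebesgue_measure A.
Proof.
move=> mA; have mf : measurable_fun setT
    (fun x : measurableTypeR R => (x + c)%R : measurableTypeR R).
  exact: measurable_funD.
rewrite -[LHS]/(pushforward lebesgue_measure
  (fun x : measurableTypeR R => (x + c)%R : measurableTypeR R) A).
apply/esym/lebesgue_measure_unique => //= _ [[a b]] _ <-.
rewrite /pushforward.
rewrite (_ : _ @^-1` _ = `](a - c)%R, (b - c)%R]%classic); last first.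
  by apply/seteqP; split=> x /=; rewrite !in_itv/= ltrBlDr lerBrDr.
rewrite !lebesgue_measure_itv/= !lte_fin ltrD2r; case: ifPn => // _.
by rewrite -!EFinB; congr EFin; ring.
Qed.

Lemma measurable_rV_box n (a b : 'rV[R]_n) :
  measurable [set x : 'rV[R]_n | forall i, (a ord0 i <= x ord0 i <= b ord0 i)%R].
Proof.
rewrite [X in measurable X](_ : _ = \bigcap_(i in [set: 'I_n])
    ((fun x : 'rV[R]_n => x ord0 i) @^-1` `[a ord0 i, b ord0 i])).
  apply: fin_bigcap_measurable => [|i _]; first exact: finite_finset.
  by apply: measurable_preimage => //; exact: measurable_rV_coord.
apply/seteqP; split=> x /= h i.
  by move=> _; rewrite /= in_itv; exact: h.
by have := h i I; rewrite /= in_itv.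
Qed.

Lemma lebesgue_rV_sigma_finite n : sigma_finite setT (@lebesgue_rV R n).
Proof.
exists (fun k => [set x : 'rV[R]_n | forall i,
  ((const_mx (- k%:R) : 'rV[R]_n) ord0 i <= x ord0 i <= (const_mx k%:R : 'rV[R]_n) ord0 i)%R]).
  apply/seteqP; split => // x _.
  exists (Num.truncn (\sum_(i < n) `|x ord0 i|)%R).+1 => //= i.
  rewrite !mxE -ler_norml.
  apply: (@le_trans _ _ (\sum_(i < n) `|x ord0 i|)%R).
    by rewrite (bigD1 i)//= lerDl sumr_ge0.
  exact/ltW/truncnS_gt.
move=> k; split; first exact: measurable_rV_box.
rewrite lebesgue_rV_box ?ltry// => i; rewrite !mxE.
by rewrite (@le_trans _ _ 0%R)// ?oppr_le0.
Qed.

(** A copy of [lebesgue_rV n] that carries the sigma-finite structure asked for by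
    Tonelli's theorem. *)
Definition sf_lebesgue_rV n : set 'rV[R]_n -> \bar R := lebesgue_rV n.
HB.instance Definition _ n := Measure.copy (@sf_lebesgue_rV n) (lebesgue_rV n).
HB.instance Definition _ n := @Measure_isSigmaFinite.Build _ _ _
  (@sf_lebesgue_rV n) (@lebesgue_rV_sigma_finite n).

(** By induction on the dimension: the shifted measure and the measure agree on
    rectangles, hence everywhere. *)
Lemma lebesgue_rV_shift n (c : 'rV[R]_n) A : measurable A ->
  lebesgue_rV n ((fun x => x + c)%R @^-1` A) = lebesgue_rV n A.
Proof.
elim: n c A => [|n IH] c A mA.
  congr (lebesgue_rV 0 _); apply/seteqP.
  by split=> x /=; rewrite (thinmx0 (x + c)%R) (thinmx0 x).
rewrite /= /prod_lebesgue /pushforward.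
pose c' : 'rV[R]_n := (\row_j c ord0 (lift ord0 j))%R.
pose S (p : 'rV[R]_n * measurableTypeR R) : 'rV[R]_n * measurableTypeR R :=
  (p.1 + c', (p.2 + c ord0 ord0)%R : measurableTypeR R)%R.
have mS : measurable_fun setT S.
  apply/measurable_fun_pairP; split => /=.
    by apply: measurable_rVD => //; exact: measurable_fst.
  by apply: measurable_funD => //; exact: measurable_snd.
have -> : @consrV R n @^-1` ((fun x => x + c)%R @^-1` A) = S @^-1` (@consrV R n @^-1` A).
  suff SE p : (consrV p + c)%R = consrV (S p) by apply/seteqP; split => p /=; rewrite SE.
  apply/rowP => i; rewrite !mxE.
  by case: unliftP => [j ->|->]; rewrite /= ?mxE.
set X := _ @^-1` A.
have mX : measurable X by apply: measurable_preimage => //; exact: measurable_consrV.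
suff H (B : set 'rV[R]_n) (C : set (measurableTypeR R)) : measurable B -> measurable C ->
    pushforward (lebesgue_rV n \x lebesgue_measure) S (B `*` C) =
    @sf_lebesgue_rV n B * lebesgue_measure C.
  apply/esym.
  by have := @product_measure_unique _ _ _ _ _ (@sf_lebesgue_rV n) (@lebesgue_measure R)
    (pushforward (lebesgue_rV n \x lebesgue_measure) S) H X mX; apply.
move=> mB mC; rewrite /pushforward.
have -> : S @^-1` (B `*` C) = ((fun x => x + c')%R @^-1` B) `*`
  ((fun x : measurableTypeR R => (x + c ord0 ord0)%R : measurableTypeR R) @^-1` C).
  by [].
rewrite product_measure1E//; last 2 first.
- by apply: measurable_preimage => //; exact: measurable_rVD.
- by apply: measurable_preimage => //; exact: measurable_funD.
by rewrite IH//; congr (_ * _); exact: lebesgue_measure_shift.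
Qed.

(** A form of the uniqueness of translation-invariant measures.  Both sides are
    the measure of the pairs [(x, y)] with [A (Phi x + y)] and [B y]: integrating
    over [x] first gives the left side, and the substitution [y := y - Phi x]
    followed by integration over [x] first gives the right side.  For a suitable
    test set [B] it determines the factor by which [Phi] changes volumes. *)
Lemma lebesgue_rV_additive_swap n (Phi Psi : 'rV[R]_n -> 'rV[R]_n) A B :
  measurable_fun setT Phi -> {morph Phi : x y / (x + y)%R} -> cancel Psi Phi ->
  measurable A -> measurable B ->
  lebesgue_rV n (Phi @^-1` A) * lebesgue_rV n B =
  lebesgue_rV n A * lebesgue_rV n ((fun x => - Phi x)%R @^-1` B).
Proof.
move=> mPhi PhiD PsiK mA mB; pose lam := @sf_lebesgue_rV n.
have PhiN x : Phi (- x)%R = (- Phi x)%R.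
  have Phi0 : Phi 0%R = 0%R by apply: (addrI (Phi 0%R)); rewrite -PhiD !addr0.
  by apply/eqP; rewrite -addr_eq0 -PhiD addrC subrr Phi0.
have mAP : measurable (Phi @^-1` A) by exact: measurable_preimage.
have mN : measurable_fun setT (fun x => - Phi x)%R.
  under eq_fun do rewrite -scaleN1r; exact: measurable_rVZ.
have mBN : measurable ((fun x => - Phi x)%R @^-1` B) by exact: measurable_preimage.
pose E := [set p : 'rV[R]_n * 'rV[R]_n | A (Phi p.1 + p.2)%R /\ B p.2].
pose E' := [set p : 'rV[R]_n * 'rV[R]_n | A p.2 /\ B (p.2 - Phi p.1)%R].
have m1 : measurable_fun setT (fun p : 'rV[R]_n * 'rV[R]_n => (Phi p.1 + p.2)%R).
  apply: measurable_rVD => //; exact: (measurableT_comp mPhi measurable_fst).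
have m2 : measurable_fun setT (fun p : 'rV[R]_n * 'rV[R]_n => (p.2 - Phi p.1)%R).
  by apply: measurable_rVD => //; exact: (measurableT_comp mN measurable_fst).
have mE : measurable E.
  by apply: measurableI; [exact: measurable_preimage m1 mA|
    exact: measurable_preimage measurable_snd mB].
have mE' : measurable E'.
  by apply: measurableI; [exact: measurable_preimage measurable_snd mA|
    exact: measurable_preimage m2 mB].
have tonelli F : measurable F ->
    \int[lam]_x lam (xsection F x) = \int[lam]_y lam (ysection F y).
  move=> mF; have := indic_fubini_tonelli lam lam mF.
  by rewrite indic_fubini_tonelli_FE// indic_fubini_tonelli_GE.
have cst_on (c : \bar R) D : measurable D ->
    \int[lam]_y (if y \in D then c else 0) = c * lam D.
  move=> mD; rewrite -integral_cst// [RHS]integral_mkcond.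
  by apply: eq_integral => y _; rewrite patchE.
transitivity (\int[lam]_y lam (ysection E y)).
  rewrite -cst_on//; apply: eq_integral => y _.
  case: ifPn => [|/negP]; rewrite inE => By.
    rewrite -(lebesgue_rV_shift (Psi y) mAP); congr (lebesgue_rV n _).
    by apply/seteqP; split=> x; rewrite /ysection/= inE /E/= PhiD PsiK => // -[].
  rewrite (_ : ysection E y = set0) ?measure0//.
  by apply/seteqP; split=> x//; rewrite /ysection/= inE => -[].
rewrite -tonelli//.
transitivity (\int[lam]_x lam (xsection E' x)).
  apply: eq_integral => x _.
  have mX : measurable (xsection E' x) by exact: measurable_xsection.
  rewrite /lam/= /sf_lebesgue_rV -(lebesgue_rV_shift (Phi x) mX).
  congr (lebesgue_rV n _); apply/seteqP.
  by split=> y; rewrite /xsection/= !inE /E /E'/= addrK addrC.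
rewrite tonelli// [RHS]muleC -cst_on//; apply: eq_integral => y _.
case: ifPn => [|/negP]; rewrite inE => Ay.
  rewrite -(lebesgue_rV_shift (- Psi y) mBN); congr (lebesgue_rV n _).
  apply/seteqP; split=> x; rewrite /ysection/= inE /E'/= PhiD PhiN PsiK opprD opprK addrC.
    by case.
  by split.
rewrite (_ : ysection E' y = set0) ?measure0//.
by apply/seteqP; split=> x//; rewrite /ysection/= inE => -[].
Qed.

(** The test set is the unit cube. *)
Lemma lebesgue_rV_scale n (s : R) (A : set 'rV[R]_n) : (0 < s)%R -> measurable A ->
  lebesgue_rV n ((fun x => s *: x)%R @^-1` A) = (s^-1 ^+ n)%:E * lebesgue_rV n A.
Proof.
move=> s0 mA.
have bl (a b : R) : (a <= b)%R -> lebesgue_rV n [set x : 'rV[R]_n | forall i,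
    ((const_mx a : 'rV[R]_n) ord0 i <= x ord0 i <= (const_mx b : 'rV[R]_n) ord0 i)%R] =
    ((b - a) ^+ n)%:E.
  move=> ab; rewrite lebesgue_rV_box => [|i]; last by rewrite !mxE.
  under eq_bigr do rewrite !mxE; by rewrite prodr_const card_ord.
have := @lebesgue_rV_additive_swap n (fun x => s *: x)%R (fun x => s^-1 *: x)%R A
  [set x : 'rV[R]_n | forall i,
    ((const_mx 0 : 'rV[R]_n) ord0 i <= x ord0 i <= (const_mx 1 : 'rV[R]_n) ord0 i)%R].
rewrite bl// subr0 expr1n mule1 => ->//; last 4 first.
- exact: measurable_rVZ.
- by move=> x y; rewrite scalerDr.
- by move=> x; rewrite scalerA divff ?gt_eqF// scale1r.
- exact: measurable_rV_box.
rewrite muleC; congr (_ * _).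
have <- : ((0 - - s^-1) ^+ n)%R = (s^-1 ^+ n)%R by rewrite sub0r opprK.
rewrite -bl ?oppr_le0 ?invr_ge0 ?ltW//; congr (lebesgue_rV n _).
have ss : (s * s^-1 = 1)%R by rewrite divff// gt_eqF.
by apply/seteqP; split=> x /= h i; move: (h i); rewrite !mxE => /andP[h1 h2];
  apply/andP; split; nra.
Qed.

Lemma lebesgue_rV_eball n (r : R) : (0 < r)%R ->
  lebesgue_rV n (@eball R n 0 r) = (r ^+ n)%:E * lebesgue_rV n (eball 0 1).
Proof.
move=> r0; have -> : @eball R n 0 r = (fun x => r^-1 *: x)%R @^-1` (eball 0 1).
  apply/seteqP; split=> x; rewrite /eball/= !subr0 enormZ ?invr_ge0 1?ltW//.
    by rewrite mulrC ltr_pdivrMr// mul1r.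
  by rewrite mulrC ltr_pdivrMr// mul1r.
rewrite lebesgue_rV_scale ?invr_gt0//; last exact: measurable_eball.
by rewrite invrK.
Qed.

Lemma lebesgue_rV_unit_ball n : 0 < lebesgue_rV n (@eball R n 0 1) < +oo.
Proof.
have c0 : (0 < (n.+1%:R : R))%R by [].
have c1 : (0 <= n.+1%:R^-1 :> R)%R by rewrite invr_ge0.
apply/andP; split.
  apply: (@lt_le_trans _ _ (lebesgue_rV n [set x : 'rV[R]_n | forall i,
    ((const_mx (- n.+1%:R^-1) : 'rV[R]_n) ord0 i <= x ord0 i <=
     (const_mx (n.+1%:R^-1) : 'rV[R]_n) ord0 i)%R])).
    rewrite lebesgue_rV_box => [|i]; last by rewrite !mxE (@le_trans _ _ 0%R)// oppr_le0.
    rewrite lte_fin; apply: prodr_gt0 => i _; rewrite !mxE opprK.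
    by rewrite addr_gt0// invr_gt0.
  apply: le_measure; rewrite ?inE; [exact: measurable_rV_box|exact: measurable_eball|].
  move=> x /= h; rewrite /eball/= subr0 -(@ltr_pXn2r _ 2)// ?nnegrE ?enorm_ge0//.
  rewrite expr1n sqr_enorm; apply: (@le_lt_trans _ _ (\sum_(i < n) n.+1%:R^-2 : R)%R).
    apply: ler_sum => i _; have := h i; rewrite !mxE -exprVn -expr2 -ler_norml => hi.
    by rewrite -real_normK ?num_real// ler_pXn2r// nnegrE.
  rewrite sumr_const card_ord -[X in (_ < X)%R](@divff _ (n.+1%:R ^+ 2)) ?gt_eqF ?exprn_gt0//.
  rewrite -(mulr_natl _ n) ltr_pM2r ?invr_gt0 ?exprn_gt0//.
  by rewrite -natrX ltr_nat (leq_trans (ltnSn n))// leq_pmulr.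
apply: (@le_lt_trans _ _ (lebesgue_rV n [set x : 'rV[R]_n | forall i,
    ((const_mx (- 1) : 'rV[R]_n) ord0 i <= x ord0 i <=
     (const_mx 1 : 'rV[R]_n) ord0 i)%R])).
  apply: le_measure; rewrite ?inE; [exact: measurable_eball|exact: measurable_rV_box|].
  move=> x; rewrite /eball/= subr0 -(@ltr_pXn2r _ 2)// ?nnegrE ?enorm_ge0//.
  rewrite expr1n sqr_enorm => h i; rewrite !mxE -ler_norml.
  rewrite -(@ler_pXn2r _ 2)// ?nnegrE// expr1n real_normK ?num_real//.
  apply: le_trans (ltW h); rewrite /dot (bigD1 i)//= -expr2 lerDl.
  by apply: sumr_ge0 => j _; rewrite -expr2 sqr_ge0.
by rewrite lebesgue_rV_box ?ltry// => i; rewrite !mxE; lra.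
Qed.

Lemma unit_ball_volumeE n : lebesgue_rV n (@eball R n 0 1) = (unit_ball_volume R n)%:E.
Proof.
have /andP[h0 h1] := lebesgue_rV_unit_ball n.
by rewrite fineK// ge0_fin_numE// ltW.
Qed.

Lemma unit_ball_volume_gt0 n : (0 < unit_ball_volume R n)%R.
Proof. by rewrite -lte_fin -unit_ball_volumeE; have /andP[] := lebesgue_rV_unit_ball n. Qed.

Lemma measurable_reflection n (v : 'rV[R]_n) : measurable_fun setT (reflection v).
Proof.
apply: measurable_rVD => //; under eq_fun do rewrite -scaleNr.
apply: measurable_rVZ => //; apply: measurableT_comp => //.
by apply: measurable_funM => //; apply: measurable_funM => //; exact: measurable_rV_dot.
Qed.

(** The test set is the unit ball, which a reflection preserves. *)
Lemma lebesgue_rV_reflection n (v : 'rV[R]_n) A : measurable A ->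
  lebesgue_rV n (reflection v @^-1` A) = lebesgue_rV n A.
Proof.
move=> mA; have := lebesgue_rV_additive_swap (measurable_reflection v)
  (reflectionD v) (reflectionK v) mA (measurable_eball 0 1).
have -> : (fun x => - reflection v x)%R @^-1` eball 0 1 = eball 0 1.
  by apply/seteqP; split=> x; rewrite /eball/= !subr0 enormN enorm_reflection.
rewrite unit_ball_volumeE => /(congr1 (fun x => x * ((unit_ball_volume R n)^-1)%:E)).
by rewrite -!muleA -!EFinM divff ?gt_eqF ?unit_ball_volume_gt0// !mule1.
Qed.

(** A reflection takes the axis to the first coordinate axis, where the cylinder is
    a product of a ball and an interval. *)
Lemma lebesgue_rV_cylinder n (z nu : 'rV[R]_n.+1) (s1 s2 b : R) :
  enorm nu = 1%R -> (0 < b)%R -> (s1 <= s2)%R ->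
  measurable (cylinder z nu s1 s2 b) /\
  lebesgue_rV n.+1 (cylinder z nu s1 s2 b) = (unit_ball_volume R n * b ^+ n * (s2 - s1))%:E.
Proof.
move=> nu1 b0 s12; set C := cylinder _ _ _ _ _.
pose e : 'rV[R]_n.+1 := delta_mx ord0 ord0.
have dote (x : 'rV[R]_n.+1) : dot x e = x ord0 ord0.
  rewrite /dot (bigD1 ord0)//= mxE !eqxx mulr1 big1 ?addr0// => i i0.
  by rewrite mxE (negbTE i0) andbF mulr0.
pose H : 'rV[R]_n.+1 -> 'rV[R]_n.+1 := reflection (e - nu).
have He : H e = nu.
  by apply: reflection_swap; rewrite nu1 enormE dote mxE !eqxx sqrtr1.
pose tl (x : 'rV[R]_n.+1) : 'rV[R]_n := (\row_j x ord0 (lift ord0 j))%R.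
have tlE (x : 'rV[R]_n.+1) : enorm (x - x ord0 ord0 *: e)%R = enorm (tl x).
  rewrite !enormE; congr Num.sqrt; rewrite /dot big_ord_recl !mxE !eqxx mulr1 subrr mul0r add0r.
  by apply: eq_bigr => i _; rewrite !mxE eqxx/= !mulr0 !subr0.
pose C0 := [set y : 'rV[R]_n.+1 | (s1 <= y ord0 ord0 <= s2)%R /\ (enorm (tl y) < b)%R].
have mtl : measurable_fun setT tl.
  apply: measurable_fun_rVP => i; under eq_fun do rewrite mxE.
  exact: measurable_rV_coord.
have mC0 : measurable C0.
  apply: measurableI.
    rewrite [X in measurable X](_ : _ = (fun y : 'rV[R]_n.+1 => y ord0 ord0) @^-1` `[s1, s2]).
      by apply: measurable_preimage => //; exact: measurable_rV_coord.
    by apply/seteqP; split => y; rewrite /= in_itv.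
  rewrite [X in measurable X](_ : _ = tl @^-1` eball 0 b).
    by apply: measurable_preimage => //; exact: measurable_eball.
  by apply/seteqP; split => y; rewrite /eball/= subr0.
have CE : C = (fun x => x - z)%R @^-1` (H @^-1` C0).
  have dotnu (w : 'rV[R]_n.+1) : dot w nu = H w ord0 ord0.
    by rewrite -He -(dot_reflection (e - nu)) /H reflectionK dote.
  have perp (w : 'rV[R]_n.+1) : enorm (w - dot w nu *: nu)%R = enorm (tl (H w)).
    rewrite -(enorm_reflection (e - nu)) -tlE dotnu; congr enorm.
    by rewrite /H reflectionB reflectionZ -/H -[in LHS]He [H (H e)]reflectionK.
  by apply/seteqP; split=> y; rewrite /C /cylinder /C0/= perp dotnu.
have mHC0 : measurable (H @^-1` C0).
  by apply: measurable_preimage => //; exact: measurable_reflection.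
rewrite CE; split.
  by apply: measurable_preimage => //; exact: measurable_rVD.
rewrite lebesgue_rV_shift// lebesgue_rV_reflection// /= /prod_lebesgue /pushforward.
rewrite (_ : _ @^-1` C0 = eball 0 b `*` `[s1, s2]); last first.
  have tlc p : tl (consrV p) = p.1 by apply/rowP => j; rewrite mxE consrV_lift.
  by apply/seteqP; split=> p; rewrite /C0 /eball/= consrV0 tlc subr0 in_itv/= => -[].
rewrite product_measure1E//; last exact: measurable_eball.
rewrite lebesgue_rV_eball// unit_ball_volumeE -EFinM.
rewrite [X in _ * X = _](_ : _ = (s2 - s1)%:E).
  by rewrite -EFinM; congr EFin; ring.
apply: (eq_trans (lebesgue_measure_itv `[s1, s2])); rewrite /= lte_fin.
case: ltP => [_|s21]; first by rewrite EFinB.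
by congr EFin; lra.
Qed.

End lebesgue_rV_theory.

(** * Steps towards the boundary *)

Section geometry.
Context {R : realType} {d : nat}.
Implicit Types x y z p : 'rV[R]_d.
Variable Omega : set 'rV[R]_d.

(** The segment from [z] to a point outside the domain meets the frontier, and the
    meeting point is no farther from [z] than that point. *)
Lemma eball_sub_domain z y : Omega z -> enorm (y - z) < bdist Omega z -> Omega y.
Proof.
move=> Oz yz; apply: contrapT => Oy.
pose g (s : R) := z + s *: (y - z).
(* The times up to which the segment stays in the domain. *)
pose S := [set s : R | 0 <= s <= 1 /\ forall s', 0 <= s' <= s -> Omega (g s')].
have S0 : S 0.
  split; first by rewrite lexx ler01.
  move=> s'; rewrite -eq_le eq_sym => /eqP ->; by rewrite /g scale0r addr0.
have Ssup : has_sup S by split; [exists 0|exists 1 => s [/andP[]]].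
set s0 := sup S.
have s0_ge0 : 0 <= s0 by apply: ub_le_sup => //; have [] := Ssup.
have s0_le1 : s0 <= 1 by apply: sup_le_ub; [exists 0|move=> s [/andP[]]].
have Sdown s' : 0 <= s' -> s' < s0 -> Omega (g s').
  move=> s'0 s's; have [|s [_ Ss] ss] := @sup_adherent _ S (s0 - s') _ Ssup.
    by rewrite subr_gt0.
  by apply: Ss; rewrite s'0/=; move: ss; rewrite subKr => /ltW.
have cg : {for s0, continuous g}.
  apply: cvgD; first exact: cvg_cst.
  by apply: cvgZr_tmp; exact: cvg_id.
have near_s0 B : nbhs (g s0) B -> exists2 e : R, 0 < e & forall s, `|s - s0| < e -> B (g s).
  move=> /cg; rewrite /= nbhs_simpl/= => /nbhs_ballP[e/= e0 he]; exists e => // s hs.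
  by apply: he; rewrite /ball/= distrC.
have fr : frontier Omega (g s0).
  split.
    move=> B /near_s0[e e0 he].
    have [s Ss ss] := sup_adherent e0 Ssup.
    exists (g s); split; first by apply: Ss.2; rewrite lexx andbT; case/andP: Ss.1.
    apply: he; have : s <= s0 by apply: ub_le_sup => //; have [] := Ssup.
    by rewrite -/s0 in ss; rewrite ltr_norml; lra.
  rewrite /interior/= => /near_s0[e e0 he].
  pose s1 := Num.min 1 (s0 + e / 2).
  have s1le : s1 <= s0 + e / 2 by rewrite /s1 ge_min lexx orbT.
  have s1le1 : s1 <= 1 by rewrite /s1 ge_min lexx.
  have s1ge : s0 <= s1 by rewrite /s1 le_min s0_le1/=; lra.
  have SS1 : S s1.
    split; first by lra.
    move=> s' /andP[s'0 s's]; have [ss|ss] := ltP s' s0; first exact: Sdown.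
    by apply: he; rewrite ltr_norml; lra.
  have : s1 <= s0 by apply: ub_le_sup => //; have [] := Ssup.
  move=> s10; have s11 : s1 = 1.
    by move: s10; rewrite {1}/s1 /Num.min; case: ifPn => //; lra.
  apply: Oy; have := SS1.2 1; rewrite s11 lexx ler01 /g scale1r addrC subrK; exact.
have := edist_le z fr; rewrite -/(bdist Omega z) /g opprD addNKr enormN enormZ//.
have := enorm_ge0 (y - z); nra.
Qed.

(** In the orthogonal frame along the axis, both distances reduce to Pythagoras. *)
Lemma cylinder_coordinates z p (D s1 s2 b : R) y : 0 < D -> enorm (p - z) = D ->
  let nu := D^-1 *: (p - z) in
  cylinder z nu s1 s2 b y ->
  let a := dot (y - z) nu in let w := enorm (y - z - a *: nu) ^+ 2 in
  [/\ s1 <= a <= s2, 0 <= w <= b ^+ 2,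
      enorm (y - z) ^+ 2 = a ^+ 2 + w & enorm (y - p) ^+ 2 = (D - a) ^+ 2 + w].
Proof.
move=> D0 pz nu [ab wb] a w.
have nu1 : dot nu nu = 1.
  by rewrite -sqr_enorm enormZ ?invr_ge0 ?ltW// pz mulVf ?gt_eqF// expr1n.
have Dnu : D *: nu = p - z by rewrite /nu scalerA divff ?gt_eqF// scale1r.
clearbody nu.
have sub_nu q k : dot (q - k *: nu) (q - k *: nu) = dot q q - 2 * k * dot q nu + k ^+ 2.
  by rewrite !(dotBl, dotBr, dotZl, dotZr) nu1 (dotC nu); ring.
have wE : w = dot (y - z) (y - z) - a ^+ 2.
  by rewrite /w sqr_enorm sub_nu -/a; ring.
have b0 : 0 <= b by apply: le_trans (ltW wb); exact: enorm_ge0.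
split => //.
- by rewrite sqr_ge0/= ler_pXn2r// ?nnegrE ?enorm_ge0// ltW.
- by rewrite wE sqr_enorm; ring.
- have -> : y - p = (y - z) - D *: nu by rewrite Dnu opprB addrA subrK.
  by rewrite sqr_enorm sub_nu wE -/a; ring.
Qed.

End geometry.

Section good.
Context {R : realType} {d : nat}.
Implicit Types x y z p : 'rV[R]_d.
Variables (Omega : set 'rV[R]_d) (eps t : R).
Hypotheses (eps0 : 0 < eps) (tb : 0 < t <= 1/2).

(** The disjunction is there because an end point within [one_step_range] costs
    only one further step of length at most [eps].  The lower bound on the length
    makes every efficient step gain a fixed amount, so that paths end. *)
Definition good_step x y :=
  [/\ eps / 4 <= enorm (y - x) < eps,
      bdist Omega x <= one_step_range t * eps -> bdist Omega y <= eps &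
      bdist Omega y <= one_step_range t * eps \/
      enorm (y - x) <= (1 + 2 * t) * (bdist Omega x - bdist Omega y)].

Definition step_cylinder z nu : set 'rV[R]_d :=
  cylinder z nu (near_end t * eps) (far_end t * eps) (Num.sqrt (sqradius t) * eps).

Lemma sqradius_ge0 : 0 <= sqradius t.
Proof. by case/andP: tb => t0 t1; rewrite /sqradius mulr_ge0 ?sqr_ge0//; lra. Qed.

Lemma sqr_radius : (Num.sqrt (sqradius t) * eps) ^+ 2 = sqradius t * eps ^+ 2.
Proof. by rewrite exprMn sqr_sqrtr// sqradius_ge0. Qed.

Lemma wide_cylinder_sub z nu s1 : Omega z -> eps < bdist Omega z -> enorm nu = 1 -> 0 <= s1 ->
  cylinder z nu s1 (far_end t * eps) (Num.sqrt (sqradius t) * eps) `<=` Omega.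
Proof.
move=> Oz ez nu1 s10 y Cy; apply: (eball_sub_domain Oz).
apply: lt_trans ez.
have pz : enorm (z + nu - z) = 1 by rewrite addrC addKr.
have := @cylinder_coordinates _ _ z (z + nu) 1 s1 (far_end t * eps)
  (Num.sqrt (sqradius t) * eps) y ltr01 pz.
have -> : 1^-1 *: (z + nu - z) = nu by rewrite invr1 scale1r addrC addKr.
move=> /(_ Cy) /=; rewrite sqr_radius.
set a := dot _ _; set w := enorm (_ - _ *: _) ^+ 2 => -[/andP[a1 a2] /andP[w0 w1] rE _].
have e0 : eps != 0 by rewrite gt_eqF.
have e2 : 0 < eps ^+ 2 by exact: exprn_gt0.
have e0' := ltW eps0; have e2' := ltW e2.
have := @step_length_lt1 _ t (a / eps) (w / eps ^+ 2) (enorm (y - z) / eps) tb.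
have -> : 0 <= a / eps <= far_end t.
  by rewrite divr_ge0//= ?ler_pdivrMr//; exact: le_trans a1.
have -> : 0 <= w / eps ^+ 2 <= sqradius t by rewrite divr_ge0//= ler_pdivrMr.
have -> : 0 <= enorm (y - z) / eps by rewrite divr_ge0 ?enorm_ge0.
move=> /(_ isT isT isT) h.
have /h : (enorm (y - z) / eps) ^+ 2 = (a / eps) ^+ 2 + w / eps ^+ 2.
  by rewrite !expr_div_n rE; field.
have /andP[s0 _] := slack_bounds tb.
move=> h1; have : enorm (y - z) / eps < 1 by lra.
by rewrite ltr_pdivrMr// mul1r.
Qed.

(** The two halves of [slack] are spent on the choice of an almost nearest boundary
    point [p] and on the displacement of [x] from [z]. *)
Lemma exists_step_cylinder z : Omega z -> eps < bdist Omega z ->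
  exists2 nu, enorm nu = 1 & forall x y, enorm (x - z) <= slack t / 2 * eps ->
    eps < bdist Omega x -> step_cylinder z nu y -> good_step x y.
Proof.
move=> Oz ez.
have /andP[s0 s1] := slack_bounds tb.
have [/andP[n0 n1] f1] := near_end_bounds tb.
case/andP: (tb) => t0 t1.
have se0 : 0 < slack t / 2 * eps by rewrite mulr_gt0// divr_gt0.
have [p fp zp] := edist_approx se0 (lt_trans eps0 ez).
rewrite -/(bdist Omega z) in zp.
set D := enorm (p - z).
have DE : enorm (z - p) = D by rewrite enorm_distC.
have Dz : bdist Omega z <= D by rewrite -DE; exact: edist_le.
have De : eps < D by exact: lt_le_trans Dz.
have D0 : 0 < D by exact: lt_trans De.
exists (D^-1 *: (p - z)); first by rewrite enormZ ?invr_ge0 ?ltW// mulVf// gt_eqF.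
move=> x y xz ex Cy.
have := cylinder_coordinates D0 erefl Cy; rewrite sqr_radius /=.
set a := dot _ _; set w := enorm (_ - _ *: _) ^+ 2 => -[/andP[a1 a2] /andP[w0 w1] rE ME].
rewrite DE in zp.
have e0 : eps != 0 by rewrite gt_eqF.
have e2 : 0 < eps ^+ 2 by exact: exprn_gt0.
have e0' := ltW eps0; have e2' := ltW e2.
have ab : near_end t <= a / eps <= far_end t by rewrite ler_pdivlMr// ler_pdivrMr// a1.
have a0 : 0 <= a / eps <= far_end t by lra.
have wb : 0 <= w / eps ^+ 2 <= sqradius t by rewrite divr_ge0//= ler_pdivrMr.
set r := enorm (y - z) in rE; set M := enorm (y - p) in ME.
have r0 : 0 <= r / eps by rewrite divr_ge0 ?enorm_ge0.
have M0 : 0 <= M / eps by rewrite divr_ge0 ?enorm_ge0.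
have rE' : (r / eps) ^+ 2 = (a / eps) ^+ 2 + w / eps ^+ 2.
  by rewrite !expr_div_n rE; field.
have ME' : (M / eps) ^+ 2 = (D / eps - a / eps) ^+ 2 + w / eps ^+ 2.
  by rewrite !expr_div_n ME; field.
have yM : bdist Omega y <= M by exact: edist_le.
have zx : bdist Omega z <= bdist Omega x + slack t / 2 * eps.
  by apply: le_trans (edist_lipschitz z x _) _; rewrite lerD2l enorm_distC.
have yx : enorm (y - x) <= r + slack t / 2 * eps.
  by apply: le_trans (ler_dist_enorm y z x) _; rewrite lerD2l enorm_distC.
have xy : r <= enorm (y - x) + slack t / 2 * eps.
  by apply: le_trans (ler_dist_enorm y x z) _; rewrite lerD2l.
have r1 := step_length_lt1 tb a0 wb r0 rE'.
have ar : a <= r.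
  have ae : 0 <= a by apply: le_trans a1; rewrite mulr_ge0 ?ltW//; lra.
  by rewrite -(@ler_pXn2r _ 2)// ?nnegrE ?enorm_ge0// rE lerDl.
have re : r = r / eps * eps by rewrite divfK.
split.
- apply/andP; split; nra.
- move=> xt; apply: le_trans yM _.
  suff : M / eps <= 1 by rewrite ler_pdivrMr// mul1r.
  apply: (cylinder_point_in_layer tb ab wb M0 ME').
  rewrite divr_ge0//=; last exact: ltW.
  by rewrite ler_pdivrMr//; rewrite /one_step_range in xt; nra.
- have [|/ltW yt] := leP (bdist Omega y) (one_step_range t * eps); [by left|right].
  have D1 : 1 <= D / eps by rewrite ler_pdivlMr// mul1r ltW.
  have M2 : one_step_range t <= M / eps by rewrite ler_pdivlMr//; exact: le_trans yM.
  have := step_efficient tb ab wb r0 rE' M0 ME' D1 M2.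
  move=> h; have h2 : r + slack t * eps <= (1 + 2 * t) * (D - M - slack t * eps).
    by move: h; rewrite -(ler_pM2r eps0) mulrDl -(mulrA (1 + 2 * t)) !mulrBl !divfK.
  apply: (le_trans yx); apply: (@le_trans _ _ (r + slack t * eps)).
    by rewrite lerD2l ler_pM2r//; lra.
  apply: (le_trans h2); rewrite ler_pM2l; lra.
Qed.

End good.

(** * Deterministic bounds for the graph eikonal equation *)

Section eikonal.
Context {R : realType} {d : nat}.
Implicit Types (x y z : 'rV[R]_d) (Xs dXs Omega : set 'rV[R]_d).

Lemma eikonal_le Xs dXs eps (u : 'rV[R]_d -> R) x y :
  graph_eikonal Xs dXs eps u -> Xs x -> ~ dXs x -> Xs y -> 0 < enorm (y - x) < eps ->
  u x <= u y + enorm (y - x).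
Proof.
move=> [hu _] Xx dx Xy /andP[xy0 xye].
have : (0 <= (u y - u x + enorm (y - x))%:E)%E.
  rewrite -(hu x)//; apply: ereal_inf_lbound; exists y => //; split=> //; split=> //= yx.
  by move: xy0; rewrite yx subrr enorm0 ltxx.
by rewrite lee_fin; lra.
Qed.

(** The cloud is finite and the infimum is finite, so it is a minimum. *)
Lemma eikonal_attained n (f : 'I_n -> 'rV[R]_d) dXs eps (u : 'rV[R]_d -> R) i :
  graph_eikonal [set f j | j in [set: 'I_n]] dXs eps u -> ~ dXs (f i) ->
  exists2 j, f j <> f i & u (f i) = u (f j) + enorm (f j - f i).
Proof.
move=> [hu _] di; have := hu (f i) (conj (ex_intro2 _ _ i I erefl) di).
set A := (X in ereal_inf X) => A0.
pose P j := `[< punctured_ball (f i) eps (f j) >].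
pose c j := u (f j) - u (f i) + enorm (f j - f i).
have [j0 Pj0|noP] := pickP P; last first.
  move: A0; rewrite (_ : A = set0) ?ereal_inf0//.
  apply/seteqP; split=> // x [y [py [j _ fj]] _].
  by have /asboolP := noP j; apply; rewrite fj.
case: (arg_minP c Pj0) => j Pj jmin.
exists j; first by move/asboolP : Pj => [].
suff : c j = 0 by rewrite /c; lra.
have inA : A (c j)%:E.
  by exists (f j) => //; split; [exact/asboolP|exists j].
suff : (c j)%:E = 0%E by case.
rewrite -[RHS]A0; apply/eqP; rewrite eq_le (ereal_inf_lbound inA) andbT.
apply: le_ereal_inf_tmp => _ [y [py [k _ fk]] <-].
by rewrite lee_fin -fk; apply: jmin; apply/asboolP; rewrite fk.
Qed.

(** A violating point with the least value of [u] would have a neighbour that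
    violates the bound with a smaller value. *)
Lemma eikonal_ge n (f : 'I_n -> 'rV[R]_d) dXs Omega eps (u : 'rV[R]_d -> R) :
  graph_eikonal [set f j | j in [set: 'I_n]] dXs eps u ->
  dXs `<=` boundary_layer Omega (2 * eps) ->
  forall i, bdist Omega (f i) - 2 * eps <= u (f i).
Proof.
move=> hu dO i; rewrite leNgt; apply/negP => bad.
pose P j := u (f j) < bdist Omega (f j) - 2 * eps.
case: (@arg_minP _ _ 'I_n i P (u \o f) bad) => j Pj jmin.
have dj : ~ dXs (f j).
  by move=> dj; have := (dO _ dj).2; move: Pj; rewrite /P hu.2//; lra.
have [k kj uk] := eikonal_attained hu dj.
have kj0 : 0 < enorm (f k - f j).
  by rewrite lt_def enorm_ge0 andbT enorm_eq0 subr_eq0; exact/eqP.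
have : u (f j) <= u (f k).
  apply: jmin; rewrite /P; move: Pj; rewrite /P.
  have := edist_lipschitz (f j) (f k) (frontier Omega).
  rewrite -!/(bdist Omega _) enorm_distC uk; lra.
by rewrite uk; lra.
Qed.

(** Induction on the distance to the boundary, in units of the least gain
    [eps / 8] of an efficient step: its length is at least [eps / 4], and
    [1 + 2 t <= 2]. *)
Lemma eikonal_upper Xs dXs Omega eps t (u : 'rV[R]_d -> R) :
  0 < eps -> 0 < t <= 1/2 ->
  Xs `\` dXs `<=` inner_part Omega eps ->
  graph_eikonal Xs dXs eps u ->
  (forall x, Xs x -> Omega x -> eps < bdist Omega x ->
     exists2 y, Xs y & good_step Omega eps t x y) ->
  forall x, Xs x -> u x <= (1 + 2 * t) * bdist Omega x.
Proof.
move=> e0 tb inX hu next x Xx.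
case/andP: (tb) => t0 t1.
have worth := one_step_range_ge tb.
have inner y : Xs y -> ~ dXs y -> Omega y /\ eps < bdist Omega y.
  move=> Xy dy; have [Oy ny] := inX _ (conj Xy dy); split=> //.
  by rewrite ltNge; apply/negP => ye; apply: ny.
have D0 y : 0 <= bdist Omega y by exact: edist_ge0.
have [dx|dx] := pselect (dXs x).
  by rewrite hu.2// mulr_ge0//; lra.
have step y : Xs y -> ~ dXs y -> exists z, [/\ Xs z, good_step Omega eps t y z,
    u y <= u z + enorm (z - y) & (dXs z -> u y <= eps)].
  move=> Xy dy; have [Oy ey] := inner y Xy dy.
  have [z Xz gz] := next y Xy Oy ey; exists z.
  have [/andP[zy1 zy2] _ _] := gz.
  have uyz : u y <= u z + enorm (z - y) by apply: eikonal_le hu _ _ _ _ => //; lra.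
  by split=> // dz; move: uyz; rewrite (hu.2 _ dz); lra.
have near_bdry y : Xs y -> ~ dXs y -> bdist Omega y <= one_step_range t * eps -> u y <= eps.
  move=> Xy dy yt; have [z [Xz [_ /(_ yt) ze _] _ uy]] := step y Xy dy.
  by apply: uy; apply: contrapT => dz; have := (inner z Xz dz).2; lra.
suff claim k y : Xs y -> ~ dXs y -> bdist Omega y <= one_step_range t * eps + k%:R * (eps / 8) ->
    u y <= (1 + 2 * t) * bdist Omega y.
  pose k := Num.truncn (bdist Omega x / (eps / 8)).
  apply: (claim k.+1) => //; apply: (@le_trans _ _ (k.+1%:R * (eps / 8))).
    by rewrite -ler_pdivrMr ?divr_gt0//; exact/ltW/truncnS_gt.
  by rewrite lerDr; nra.
elim: k y => [|k IH] y Xy dy yk.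
  rewrite mul0r addr0 in yk; have [_ ey] := inner y Xy dy.
  apply: le_trans (near_bdry y Xy dy yk) _; nra.
have [yt|yt] := leP (bdist Omega y) (one_step_range t * eps).
  have [_ ey] := inner y Xy dy; apply: le_trans (near_bdry y Xy dy yt) _; nra.
have [z [Xz [/andP[zy1 zy2] _ gz] uy udz]] := step y Xy dy.
have [dz|dz] := pselect (dXs z).
  have [_ ey] := inner y Xy dy; apply: le_trans (udz dz) _; nra.
have [zt|zt] := leP (bdist Omega z) (one_step_range t * eps).
  have := near_bdry z Xz dz zt; nra.
have {}gz : enorm (z - y) <= (1 + 2 * t) * (bdist Omega y - bdist Omega z).
  by case: gz => // /(lt_le_trans zt); rewrite ltxx.
have : u z <= (1 + 2 * t) * bdist Omega z.
  apply: IH => //; move: yk; rewrite -[k.+1%:R]natr1; nra.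
lra.
Qed.

End eikonal.

(** * Hitting sets attached to the cells of a grid *)

Section grid.
Context {R : realType} {d : nat}.

Lemma exists_fine_grid (h : R) : 0 < h -> exists grid : 'rV[R]_d -> nat,
  (forall m, measurable (grid @^-1` [set m])) /\
  (forall x y, grid x = grid y -> enorm (x - y) <= h).
Proof.
(* A cube of side [c] has diameter [c sqrt d], which is at most [h]. *)
move=> h0; pose c := h / d.+1%:R; have c0 : 0 < c by rewrite divr_gt0.
pose corner (x : 'rV[R]_d) : 'rV[int]_d := \row_i Num.floor (x ord0 i / c).
have floorP (r : R) (k : int) : (Num.floor (r / c) == k) = (k%:~R * c <= r < (k + 1)%:~R * c).
  rewrite -ler_pdivlMr// -ltr_pdivrMr//; apply/eqP/idP => [<-|]; last exact: floor_def.
  by rewrite floor_le_tmp floorD1_gt.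
exists (fun x => pickle (corner x)); split.
  move=> m; have [[x0 x0m]|nex] := pselect (exists x, pickle (corner x) = m); last first.
    rewrite (_ : _ @^-1` _ = set0); first exact: measurable0.
    by apply/seteqP; split => // x /= xm; apply: nex; exists x.
  rewrite (_ : _ @^-1` _ = \bigcap_(i in [set: 'I_d]) ((fun x : 'rV[R]_d => x ord0 i) @^-1`
      `[(corner x0 ord0 i)%:~R * c, (corner x0 ord0 i + 1)%:~R * c[)).
    apply: fin_bigcap_measurable => [|i _]; first exact: finite_finset.
    by apply: measurable_preimage => //; exact: measurable_rV_coord.
  apply/seteqP; split => [x/= xm i _ /=|x /= hx].
    have xx0 : corner x = corner x0 by apply: (pcan_inj pickleK); rewrite xm x0m.
    by rewrite in_itv/= -floorP -xx0 mxE.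
  rewrite -x0m; congr pickle; apply/rowP => i; have := hx i I.
  by rewrite /= in_itv/= -floorP => /eqP <-; rewrite mxE.
move=> x y /(pcan_inj pickleK) xy.
rewrite -(@ler_pXn2r _ 2)// ?nnegrE ?enorm_ge0//; last exact: ltW.
rewrite sqr_enorm /dot.
apply: (@le_trans _ _ (\sum_(i < d) c ^+ 2)).
  apply: ler_sum => i _; have /rowP/(_ i) := xy; rewrite !mxE => /eqP.
  rewrite floorP; have /eqP := erefl (Num.floor (y ord0 i / c)); rewrite floorP.
  rewrite -expr2 intrD mulrDl mul1r => /andP[y1 y2] /andP[x1 x2].
  rewrite -real_normK ?num_real// ler_pXn2r ?nnegrE ?(ltW c0)//.
  by rewrite ler_norml; lra.
rewrite sumr_const card_ord -mulr_natr /c expr_div_n -mulrA ler_piMr ?sqr_ge0//.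
rewrite mulrC ler_pdivrMr ?exprn_gt0// mul1r -natrX ler_nat.
by rewrite (leq_trans (leqnSn d))// leq_pmulr.
Qed.

End grid.

Section hitting.
Context {dT} {T : measurableType dT} {R : realType} (P : probability T R).
Context {d' : measure_display} {T' : measurableType d'} {n : nat}.
Variable X : 'I_n -> {RV P >-> T'}.
Hypothesis X_ind : mutually_independent X.
Local Open Scope ereal_scope.

Let mX i A : measurable A -> measurable (X i @^-1` A).
Proof. by move=> mA; apply: measurable_preimage => //; exact: measurable_funP. Qed.

(** The events concern different sample points, so their probabilities multiply. *)
Lemma le_prod_miss i (A : set T') (C : set T') (p : R) :
  measurable A -> measurable C -> (forall j, p%:E <= P (X j @^-1` C)) ->
  P (X i @^-1` A `&` \bigcap_(j in [set j | j != i]) (X j @^-1` (~` C))) <=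
  ((1 - p) ^+ n.-1)%:E * P (X i @^-1` A).
Proof.
move=> mA mC pC; pose B j := if j == i then A else ~` C.
have mB j : measurable (B j) by rewrite /B; case: ifP => // _; exact: measurableC.
have -> : X i @^-1` A `&` \bigcap_(j in [set j | j != i]) (X j @^-1` (~` C)) =
    \bigcap_(j in [set` [set: 'I_n]%SET]) (X j @^-1` B j).
  apply/seteqP; split => w.
    move=> [Aw Cw] j _ /=; rewrite /B; case: eqVneq => [->//|ji].
    exact: Cw.
  move=> /= h; split; first by have := h i; rewrite /B eqxx; apply; rewrite /= inE.
  by move=> j /= /negbTE ji; have := h j; rewrite /B ji; apply; rewrite /= inE.
rewrite X_ind// (bigD1 i) ?inE//= {1}/B eqxx muleC.
apply: lee_wpmul2r => //.
pose q j : R := fine (P (X j @^-1` B j)).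
have PE j : P (X j @^-1` B j) = (q j)%:E.
  by rewrite fineK// fin_num_measure//; exact: mX.
under eq_bigr do rewrite PE.
rewrite prodEFin lee_fin.
have -> : ((1 - p) ^+ n.-1 = \prod_(j < n | (j \in [set: 'I_n]%SET) && (j != i)) (1 - p))%R.
  rewrite (eq_bigl (fun j => j \in predC1 i)) => [|j]; last by rewrite !inE.
  by rewrite prodr_const cardC1 card_ord.
apply: ler_prod => j /andP[_ ji]; rewrite -lee_fin -[X in X && _]lee_fin -PE measure_ge0/=.
rewrite /B (negbTE ji) preimage_setC probability_setC//; last exact: mX.
by rewrite EFinB; apply: leeB => //; exact: pC.
Qed.

(** Sample point [i] can only fail to be served through the cell [m] that contains
    it; the cells are disjoint, so the bounds for the single cells add up to one
    bound for [i], and a union bound over [i] finishes. *)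
Lemma hitting_event (grid : T' -> nat) (C : nat -> set T') (G : set nat) (p : R) :
  (0 <= p <= 1)%R ->
  (forall m, measurable (grid @^-1` [set m])) ->
  (forall m, G m -> measurable (C m) /\ forall j, p%:E <= P (X j @^-1` C m)) ->
  exists E, [/\ measurable E,
    forall w, E w -> forall i, G (grid (X i w)) -> exists j, C (grid (X i w)) (X j w) &
    (1 - n%:R * (1 - p) ^+ n.-1)%:E <= P E].
Proof.
move=> /andP[p0 p1] mgrid hC.
pose F i m := if m \in G then X i @^-1` (grid @^-1` [set m]) `&`
    \bigcap_(j in [set j | j != i]) (X j @^-1` (~` C m)) else set0.
have mF i m : measurable (F i m).
  rewrite /F; case: ifPn => // /set_mem Gm; apply: measurableI; first exact: mX.
  apply: fin_bigcap_measurable => [|j _]; first exact: finite_finset.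
  by apply: mX; apply: measurableC; exact: (hC m Gm).1.
pose bad i := \bigcup_m F i m.
have mbad i : measurable (bad i) by exact: bigcupT_measurable.
have Fsub i m : F i m `<=` X i @^-1` (grid @^-1` [set m]).
  by rewrite /F; case: ifP => // _ w [].
have tgrid i : trivIset setT (fun m => X i @^-1` (grid @^-1` [set m])).
  by move=> k l _ _ [w [/= <- <-]].
have Pbad i : P (bad i) <= ((1 - p) ^+ n.-1)%:E.
  rewrite measure_semi_bigcup//; last 2 first.
  - by move=> k l _ _ [w [/Fsub/= <- /Fsub/= <-]].
  - exact: mbad.
  apply: (@le_trans _ _ (\sum_(m <oo) (((1 - p) ^+ n.-1)%:E * 
    P (X i @^-1` (grid @^-1` [set m]))))).
    apply: lee_nneseries => [m _ _|m _]; first exact: measure_ge0.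
    rewrite {1}/F; case: ifPn => [/set_mem Gm|_].
      by apply: le_prod_miss => //; have [] := hC m Gm.
    by rewrite measure0 mule_ge0// lee_fin exprn_ge0// subr_ge0.
  rewrite nneseriesZl => [|m _]; last exact: measure_ge0.
  rewrite -[leRHS]mule1; apply: lee_wpmul2l; first by rewrite lee_fin exprn_ge0// subr_ge0.
  have mXg m : measurable (X i @^-1` (grid @^-1` [set m])) by exact: mX.
  have mU : measurable (\bigcup_m (X i @^-1` (grid @^-1` [set m]))).
    exact: bigcupT_measurable.
  by rewrite -measure_semi_bigcup//; exact: probability_le1.
pose U := \big[setU/set0]_(i < n) bad i.
have [mU PU] : measurable U /\ P U <= \sum_(i < n) P (bad i).
  rewrite /U; elim/big_rec2 : _ => [|i y A _ [mA PA]]; first by rewrite measure0.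
  split; first exact: measurableU.
  by apply: le_trans (measureU2 _ _ _) _ => //; exact: leeD2l.
exists (~` U); split; first exact: measurableC.
  move=> w Uw i Gi; apply: contrapT => nohit; apply: Uw.
  rewrite /U -bigcup_seq; exists i => /=; first by rewrite mem_index_enum.
  exists (grid (X i w)) => //; rewrite /F mem_set//; split => // j _ /= Cj.
  by apply: nohit; exists j.
rewrite probability_setC// EFinB; apply: leeB => //.
apply: (le_trans PU); apply: (@le_trans _ _ (\sum_(i < n) ((1 - p) ^+ n.-1)%:E)).
  by apply: lee_sum => i _.
by rewrite sumEFin sumr_const card_ord mulr_natl.
Qed.

End hitting.

(** * Probability estimates and the theorem *)

Section estimates.
Context {R : realType}.

Lemma le_1BMn (t : R) (k : nat) : 0 <= t <= 1 -> 1 - k%:R * t <= (1 - t) ^+ k.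
Proof.
move=> /andP[t0 t1]; elim: k => [|k IH]; first by rewrite mul0r subr0 expr0.
rewrite exprSr -natr1.
have k0 : 0 <= k%:R :> R by [].
apply: (@le_trans _ _ ((1 - k%:R * t) * (1 - t))); first by nra.
by apply: ler_wpM2r => //; lra.
Qed.

(** By Bernoulli's inequality.  The difference between the two sides, divided by [t],
    is then least for the largest admissible [t]. *)
Lemma step_volume_ge (t : R) (k : nat) : 0 < t <= 1/2 -> t * k.+1%:R <= 1 ->
  t / (2 * k.+2%:R) <= (1 - t) ^+ k * (far_end t - near_end t).
Proof.
move=> /andP[t0 t1] tk.
have tb : 0 <= t <= 1 by lra.
have := le_1BMn k tb => bern.
have -> : far_end t - near_end t = t * (1/2 - t/3) by rewrite /far_end /near_end; field.
apply: (@le_trans _ _ ((1 - k%:R * t) * (t * (1/2 - t/3)))); last first.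
  by apply: ler_wpM2r => //; apply: mulr_ge0; lra.
rewrite ler_pdivrMr ?mulr_gt0// mulrAC -mulrA.
have k0 : 0 <= k%:R :> R by [].
move: tk; rewrite -[k.+2%:R]natr1 -[k.+1%:R]natr1 => tk.
have [->|kn0] := eqVneq k 0%N; first by nra.
have k1 : 1 <= k%:R :> R by rewrite ler1n lt0n.
set K : R := k%:R in tk k0 k1 *.
have h1 : 0 <= (1 - t * (K + 1)) by lra.
have h2 : 1 <= (1 - K * t) * (1 / 2 - t / 3) * (2 * (K + 1 + 1)).
  have h3 : t <= 1 - K * t by lra.
  have : 0 <= (1 - t * (K + 1)) * (K - 1) by apply: mulr_ge0; lra.
  have : 0 <= (1 - t * (K + 1)) * (1 - t * (K + 1)) by apply: mulr_ge0; lra.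
  nra.
nra.
Qed.

(** The exponent [n - 1] is turned into [n] at the price [exp x <= 2]. *)
Lemma miss_prob_le (n : nat) (p x : R) : 0 <= x <= p -> p <= 1 -> x <= 1/2 ->
  n%:R * (1 - p) ^+ n.-1 <= 2 * n%:R * expR (- (n%:R * x)).
Proof.
move=> /andP[x0 xp] p1 x2; case: n => [|m]; first by rewrite mulr0 !mul0r.
rewrite [2 * _]mulrC -mulrA ler_pM2l//=.
have e1 : 1/2 <= expR (- x) by apply: le_trans (expR_ge1Dx _); lra.
apply: (@le_trans _ _ (expR (- x) ^+ m)).
  rewrite lerXn2r ?nnegrE ?expR_ge0//; first by lra.
  by apply: le_trans (expR_ge1Dx _); lra.
rewrite -mulrN expRM_natl exprS mulrA ler_peMl ?exprn_ge0 ?expR_ge0//; lra.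
Qed.

End estimates.

Section density.
Context {dT} {T : measurableType dT} {R : realType} (P : probability T R).

Lemma density_ge {d} (X : {RV P >-> 'rV[R]_d}) (rho : 'rV[R]_d -> R) (rho_min V : R)
    (Omega C : set 'rV[R]_d) :
  is_density rho -> has_density X rho -> 0 <= rho_min ->
  (forall x, Omega x -> rho_min <= rho x) ->
  measurable C -> C `<=` Omega -> lebesgue_rV d C = V%:E ->
  ((rho_min * V)%:E <= P (X @^-1` C))%E.
Proof.
move=> [mrho rho0 _] hX rm0 hrho mC CO CV.
have -> : P (X @^-1` C) = (\int[lebesgue_rV d]_(x in C) (rho x)%:E)%E by rewrite -hX.
rewrite EFinM -CV -integral_cst//; apply: ge0_le_integral => //.
- by apply/measurable_EFinP; apply: measurable_funS mrho.
- by move=> x /CO /hrho; rewrite lee_fin.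
Qed.

End density.

Section step_probability.
Context {R : realType}.

(** [rho_min] times the volume of a step cylinder in dimension [k + 1]. *)
Definition step_prob k (rho_min eps t : R) : R :=
  rho_min * (unit_ball_volume R k * (Num.sqrt (sqradius t) * eps) ^+ k *
    (far_end t * eps - near_end t * eps)).

Lemma step_prob_ge k (rho_min eps t : R) : 0 <= rho_min -> 0 <= eps -> 0 < t <= 1/2 ->
  t * k.+1%:R <= 1 ->
  unit_ball_volume R k / (4 * k.+2%:R) * rho_min * eps ^+ k.+1 *
    (2 * t) `^ (k.+2%:R / 2) <= step_prob k rho_min eps t.
Proof.
move=> rm0 e0 tb tk; case/andP: (tb) => t0 t1.
have t20 : 0 <= 2 * t by lra.
have -> : (2 * t) `^ (k.+2%:R / 2) = Num.sqrt (2 * t) ^+ k * (2 * t).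
  rewrite [_ / 2]mulrC powRrM powR12_sqrt// powR_mulrn ?sqrtr_ge0//.
  by rewrite 2!exprSr -mulrA -expr2 sqr_sqrtr.
rewrite /step_prob; have -> : Num.sqrt (sqradius t) = Num.sqrt (2 * t) * (1 - t).
  by rewrite /sqradius sqrtrM// sqrtr_sqr ger0_norm//; lra.
have := step_volume_ge tb tk => vol.
have c0 : 0 <= rho_min * unit_ball_volume R k * eps ^+ k.+1 * Num.sqrt (2 * t) ^+ k.
  by rewrite !mulr_ge0 ?exprn_ge0 ?sqrtr_ge0 ?(ltW (unit_ball_volume_gt0 k)).
apply: le_trans (le_trans (ler_wpM2l c0 vol) _).
  rewrite le_eqVlt; apply/orP; left; apply/eqP; field.
  by apply: lt0r_neq0; have : 0 <= k%:R :> R by []; lra.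
rewrite le_eqVlt; apply/orP; left; apply/eqP.
by rewrite !exprMn exprS; ring.
Qed.

End step_probability.

Theorem theorem6p4 (R : realType) (d : nat) (hd : (0 < d)%N)
  (Omega : set 'rV[R]_d) (hOmega : bounded_domain Omega)
  (R0 : R) (hR0 : 0 < R0)
  (reach_Omega : (R0%:E <= reach Omega)%E)
  (reach_OmegaC : (R0%:E <= reach (~` Omega))%E)
  (rho : 'rV[R]_d -> R) (rho_density : is_density rho)
  (rho_min rho_max : R) (rho_min_gt0 : 0 < rho_min)
  (rho_bounds : forall x, Omega x -> rho_min <= rho x <= rho_max)
  (rho_out : forall x, ~ Omega x -> rho x = 0)
  (rho_lipschitz : [lipschitz rho x | x in Omega])
  (dT : measure_display) (T : measurableType dT) (P : probability T R)
  (n : nat) (X : 'I_n -> {RV P >-> 'rV[R]_d})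
  (X_iid : iid_sample X rho)
  (eps : R) (eps_gt0 : 0 < eps) (eps_le : eps <= R0 / 8)
  (t : R) (t_gt0 : 0 < t)
  (t_le : t <= Num.min (1 / d%:R) (1 / 2 - 4 * eps / R0)) :
  holds_with_probability_at_least P
    (1 - 2 * n%:R * expR (- (unit_ball_volume R d.-1 / (4 * d.+1%:R)
       * rho_min * n%:R * eps ^+ d * (2 * t) `^ (d.+1%:R / 2))))
    [set w |
      forall (dX : set 'rV[R]_d) (u : 'rV[R]_d -> R),
        dX `<=` point_cloud X w ->
        point_cloud X w `\` dX `<=` inner_part Omega eps ->
        dX `<=` boundary_layer Omega (2 * eps) ->
        graph_eikonal (point_cloud X w) dX eps u ->
        forall x, point_cloud X w x ->
          - (2 * eps) <= u x - bdist Omega x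
            <= 2 * bdist Omega x * (t + 4 * eps / R0)].
Proof.
case: d hd Omega hOmega reach_Omega reach_OmegaC rho rho_density rho_bounds rho_out
  rho_lipschitz X X_iid t_le => // k _ {}Omega _ _ _ {}rho rho_density rho_bounds
  _ _ {}X [X_ind X_den] t_le.
have tb : 0 < t <= 1/2.
  rewrite t_gt0 (le_trans t_le)// ge_min; apply/orP; right.
  by rewrite lerBlDr lerDl divr_ge0 ?mulr_ge0 ?ltW.
have tk : t * k.+1%:R <= 1.
  by rewrite -ler_pdivlMr//; apply: le_trans t_le _; rewrite ge_min lexx.
have deterministic w dX (u : 'rV[R]_k.+1 -> R) :
    point_cloud X w `\` dX `<=` inner_part Omega eps ->
    dX `<=` boundary_layer Omega (2 * eps) ->
    graph_eikonal (point_cloud X w) dX eps u ->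
    (forall x, point_cloud X w x -> Omega x -> eps < bdist Omega x ->
       exists2 y, point_cloud X w y & good_step Omega eps t x y) ->
    forall x, point_cloud X w x -> - (2 * eps) <= u x - bdist Omega x
            <= 2 * bdist Omega x * (t + 4 * eps / R0).
  move=> inX dO hu next x Xx; apply/andP; split.
    by have [i _ <-] := Xx; have := eikonal_ge hu dO i; lra.
  have := eikonal_upper eps_gt0 tb inX hu next Xx.
  have : 0 <= 2 * bdist Omega x * (4 * eps / R0).
    by rewrite !mulr_ge0 ?edist_ge0 ?invr_ge0 ?ltW.
  lra.
set x := unit_ball_volume R k / (4 * k.+2%:R) * rho_min * eps ^+ k.+1 *
  (2 * t) `^ (k.+2%:R / 2).
have -> : unit_ball_volume R k.+1.-1 / (4 * k.+2%:R) * rho_min * n%:R * eps ^+ k.+1 *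
    (2 * t) `^ (k.+2%:R / 2) = n%:R * x by rewrite /x /=; ring.
(* If no point of the domain is deeper than [eps], all sample points are declared
   boundary points. *)
have [[z0 [Oz0 ez0]]|empty] := pselect (exists z, Omega z /\ eps < bdist Omega z); last first.
  exists setT; split => //; last first.
    by rewrite probability_setT lee_fin lerBlDr lerDl !mulr_ge0// expR_ge0.
  move=> w _ dX u _ inX dO hu; apply: deterministic inX dO hu _.
  by move=> y _ Oy ey; exfalso; apply: empty; exists y.
have rm0 := ltW rho_min_gt0.
have rho_ge y : Omega y -> rho_min <= rho y by move=> /rho_bounds/andP[].
have [/andP[n0 n1] f1] := near_end_bounds tb.
have b0 : 0 < Num.sqrt (sqradius t) * eps.
  by case/andP: (tb) => ? ?; rewrite mulr_gt0// sqrtr_gt0 /sqradius mulr_gt0 ?exprn_gt0//; lra.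
pose p := step_prob k rho_min eps t.
have xp : x <= p by apply: step_prob_ge => //; exact: ltW.
have cylV z nu s1 : enorm nu = 1 -> s1 <= far_end t * eps ->
    measurable (cylinder z nu s1 (far_end t * eps) (Num.sqrt (sqradius t) * eps)) /\
    lebesgue_rV k.+1 (cylinder z nu s1 (far_end t * eps) (Num.sqrt (sqradius t) * eps)) =
      (unit_ball_volume R k * (Num.sqrt (sqradius t) * eps) ^+ k * (far_end t * eps - s1))%:E.
  by move=> nu1 s1f; exact: lebesgue_rV_cylinder.
have x0 : 0 <= x.
  by rewrite /x !mulr_ge0 ?invr_ge0 ?exprn_ge0 ?powR_ge0 ?(ltW eps_gt0)
    ?(ltW (unit_ball_volume_gt0 _)).
case: n X X_ind X_den deterministic => [|n'] {}X X_ind X_den deterministic.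
  exists setT; split => //; last first.
    by rewrite probability_setT lee_fin lerBlDr lerDl !mulr_ge0// expR_ge0.
  by move=> w _ dX u _ _ _ _ y [[]].
(* Some sample point exists, and a cylinder of twice the height still lies in the
   domain, so it has probability [2 p] at least. *)
have p2 : p <= 1/2.
  have [nu nu1 _] := exists_step_cylinder eps_gt0 tb Oz0 ez0.
  pose s1 := (2 * near_end t - far_end t) * eps.
  have s1f : s1 <= far_end t * eps by rewrite ler_pM2r//; lra.
  have s10 : 0 <= s1 by rewrite mulr_ge0 ?(ltW eps_gt0)//; lra.
  have [mC VC] := cylV z0 nu s1 nu1 s1f.
  have CO := wide_cylinder_sub eps_gt0 tb Oz0 ez0 nu1 s10.
  have := density_ge rho_density (X_den ord0) rm0 rho_ge mC CO VC.
  have mXC : measurable (X ord0 @^-1` cylinder z0 nu s1 (far_end t * eps)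
      (Num.sqrt (sqradius t) * eps)).
    by apply: measurable_preimage => //; exact: measurable_funP.
  move=> /le_trans/(_ (probability_le1 P mXC)); rewrite lee_fin /s1 /p /step_prob; nra.
have se0 : 0 < slack t / 2 * eps.
  by rewrite mulr_gt0// divr_gt0//; have /andP[] := slack_bounds tb.
have [grid [mgrid grid_fine]] := @exists_fine_grid R k.+1 _ se0.
(* The cells that a sample point needing a step can lie in; any such point of the
   cell serves as its representative. *)
pose G := [set m | exists z, [/\ Omega z, eps < bdist Omega z & grid z = m]].
have hC m : exists C : set 'rV[R]_k.+1, G m ->
    [/\ measurable C, forall j, (p%:E <= P (X j @^-1` C))%E &
        forall y y', grid y = m -> eps < bdist Omega y -> C y' -> good_step Omega eps t y y'].
  have [[z [Oz ez zm]]|nG] := pselect (G m); last by exists set0.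
  have [nu nu1 good] := exists_step_cylinder eps_gt0 tb Oz ez.
  have s1f : near_end t * eps <= far_end t * eps by rewrite ler_pM2r.
  have [mC VC] := cylV z nu _ nu1 s1f.
  exists (step_cylinder eps t z nu) => _; split=> //.
    move=> j; apply: density_ge (X_den j) rm0 rho_ge mC _ VC => //.
    by apply: wide_cylinder_sub => //; rewrite mulr_ge0 ?(ltW eps_gt0)//; lra.
  by move=> y y' ym ey; apply: good => //; apply: grid_fine; rewrite ym zm.
have [C CP] := choice hC.
have p01 : 0 <= p <= 1 by rewrite (le_trans x0 xp)/=; lra.
have [E [mE hE PE]] := hitting_event X_ind p01 mgrid
  (fun m Gm => let: And3 a b _ := CP m Gm in conj a b).
exists E; split => //.
  move=> w Ew dX u _ inX dO hu; apply: deterministic inX dO hu _.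
  move=> y [i _ <-] Oy ey; have Gi : G (grid (X i w)) by exists (X i w).
  have [j Cj] := hE w Ew i Gi; exists (X j w); first by exists j.
  by have [_ _] := CP _ Gi; apply.
apply: le_trans PE; rewrite lee_fin lerB//.
by apply: miss_prob_le; rewrite ?x0//; lra.
Qed.
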